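(* Let $(R,\mathfrak m)$ be an F-finite regular local ring of characteristic $p>0$ and let $I\subsetneq R$ be an unmixed reduced (i.e. radical) ideal of height $h>0$. Let $\mathfrak a_1,\dots,\mathfrak a_k$ be ideals of $R$ and $t_1,\dots,t_k>0$ real numbers. Write $S=R/I$. (1) If the pair $(S,(\mathfrak a_1S)^{t_1}\cdots(\mathfrak a_kS)^{t_k})$ is strongly F-regular (resp. F-pure), then the pair $(R, I\,\mathfrak a_1^{t_1}\cdots\mathfrak a_k^{t_k})$ (with exponent $1$ on $I$) is purely F-regular (resp. F-pure). (2) If the pair $(R, I^h\mathfrak a_1^{t_1}\cdots\mathfrak a_k^{t_k})$ (with exponent $h$ on $I$) is F-pure, then the pair $(S,(\mathfrak a_1S)^{t_1}\cdots(\mathfrak a_kS)^{t_k})$ is F-pure. In addition, suppose all $\mathfrak a_i$ contain $I$. If the pair $(R, I^h\mathfrak a_1^{t_1}\cdots\mathfrak a_k^{t_k})$ is purely F-regular, then the pair $(S,(\mathfrak a_1S)^{t_1}\cdots(\mathfrak a_kS)^{t_k})$ is strongly F-regular.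
   Context: All rings are reduced commutative rings with unity. For a ring $A$, $A^\circ$ denotes the set of elements of $A$ not in any minimal prime ideal of $A$. A reduced ring $A$ of characteristic $p>0$ is F-finite if $A^{1/p}$ is a finitely generated $A$-module. Throughout, $q=p^e$ denotes a power of $p$ with $e>0$ an integer, and $A^{1/q}$ is the ring of $q$-th roots of elements of $A$. For $x\in A$, ''$x^{1/q}A\hookrightarrow A^{1/q}$ splits'' means that the $A$-linear map $A\to A^{1/q}$, $1\mapsto x^{1/q}$, splits as an $A$-module homomorphism. Let $\mathfrak b_1,\dots,\mathfrak b_n$ be ideals of an F-finite reduced ring $A$ of characteristic $p$ and $s_1,\dots,s_n>0$ real numbers. The pair $(A,\mathfrak b_1^{s_1}\cdots\mathfrak b_n^{s_n})$ is: (i) F-pure if for all large $q=p^e$ there exists $d\in\mathfrak b_1^{\lfloor s_1(q-1)\rfloor}\cdots\mathfrak b_n^{\lfloor s_n(q-1)\rfloor}$ such that $d^{1/q}A\hookrightarrow A^{1/q}$ splits; (ii) strongly F-regular if for every $c\in A^\circ$ there exist $q=p^e$ and $d\in\mathfrak b_1^{\lfloor s_1(q-1)\rfloor}\cdots\mathfrak b_n^{\lfloor s_n(q-1)\rfloor}$ such that $(cd)^{1/q}A\hookrightarrow A^{1/q}$ splits; (iii) purely F-regular if for every $c\in A^\circ$ which is not in any minimal prime ideal of $\mathfrak b_1\cdots\mathfrak b_n$, there exists $q'$ such that for all $q=p^e\ge q'$ there is $d\in\mathfrak b_1^{\lfloor s_1(q-1)\rfloor}\cdots\mathfrak b_n^{\lfloor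 s_n(q-1)\rfloor}$ such that $(cd)^{1/q}A\hookrightarrow A^{1/q}$ splits. The ideal $I$ being unmixed means that all its associated primes have the same height $h$.
   Formalization: In (1), the implication from strongly F-regular to purely F-regular is stated with the extra assumption that if I = m (so S is a field) then no a_i is contained in m; without it the claim fails, e.g. R = F_p[x] localized at (x), I = a_1 = (x), t_1 = 1/p. *)

(* Defs.v *)
From HB Require Import structures.
From mathcomp Require Import all_boot all_order all_algebra.
From mathcomp Require Import all_classical reals.

Set Implicit Arguments.
Unset Strict Implicit.
Unset Printing Implicit Defensive.

Import Order.TTheory GRing.Theory Num.Theory.
Local Open Scope classical_set_scope.
Local Open Scope ring_scope.
Local Open Scope quotient_scope.

Section Ideals.
Context {A : comNzRingType}.
Implicit Types (I J M P Q : set A).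

(* Unlike [idealr A], the unit ideal is allowed. *)
Definition is_ideal J : Prop :=
  [/\ J 0, forall x y, J x -> J y -> J (x + y) & forall a x, J x -> J (a * x)].

Definition ideal_gen (X : set A) : set A := smallest is_ideal X.

Definition ideal_mul I J : set A :=
  ideal_gen [set z | exists x y, [/\ I x, J y & z = x * y]].

Definition ideal_exp J (n : nat) : set A := iter n (ideal_mul J) setT.

Definition is_prime P : Prop :=
  [/\ is_ideal P, ~ P 1 & forall x y, P (x * y) -> P x \/ P y].

Definition is_maximal M : Prop :=
  [/\ is_ideal M, ~ M 1 &
      forall J, is_ideal J -> ~ J 1 -> M `<=` J -> J = M].

Definition minimal_prime_of J P : Prop :=
  [/\ is_prime P, J `<=` P &
      forall Q, is_prime Q -> J `<=` Q -> Q `<=` P -> Q = P].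

Definition radical_ideal J : Prop := forall x (n : nat), J (x ^+ n) -> J x.

(* Strictly increasing chains of primes c 0 < ... < c n, of length n. *)
Definition prime_chain (c : nat -> set A) (n : nat) : Prop :=
  (forall i, (i <= n)%N -> is_prime (c i)) /\
  (forall i, (i < n)%N -> c i `<` c i.+1).

(* Heights and dimension are relations: [prime_height P n] says that the height
   of P is finite and equal to n, and similarly below. *)
Definition prime_height P (n : nat) : Prop :=
  (exists2 c, prime_chain c n & c n = P) /\
  (forall c l, prime_chain c l -> c l = P -> (l <= n)%N).

Definition ideal_height J (h : nat) : Prop :=
  (exists P, [/\ is_prime P, J `<=` P & prime_height P h]) /\
  (forall P n, is_prime P -> J `<=` P -> prime_height P n -> (h <= n)%N).

(* P is the annihilator of the class of some x in A / J. *)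
Definition associated_prime J P : Prop :=
  is_prime P /\ exists x, P = [set a | J (a * x)].

Definition unmixed J (h : nat) : Prop :=
  forall P, associated_prime J P -> prime_height P h.

End Ideals.

Definition noetherian (A : comNzRingType) : Prop :=
  forall J : set A, is_ideal J -> exists s : seq A, J = ideal_gen [set` s].

Definition krull_dim (A : comNzRingType) (d : nat) : Prop :=
  (exists c : nat -> set A, prime_chain c d) /\
  (forall (c : nat -> set A) l, prime_chain c l -> (l <= d)%N).

Definition local_ring (A : comNzRingType) (m : set A) : Prop :=
  is_maximal m /\ forall n : set A, is_maximal n -> n = m.

Definition regular_local_ring (A : comNzRingType) (m : set A) : Prop :=
  [/\ noetherian A, local_ring m &
      exists s : seq A, krull_dim A (size s) /\ m = ideal_gen [set` s]].

Definition ideal_ext (A B : comNzRingType) (f : A -> B) (J : set A) : set B :=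
  ideal_gen (f @` J).

(* A^{1/q} for q = p ^ e: a copy of the ring A in which x stands for x^{1/q},
   so that a in A is identified with (a ^ q)^{1/q}.  When A is reduced this is
   the ring of q-th roots of elements of A; see [rth_rootK], [root_incl_inj] and
   [rth_root_surj]. *)
Definition root_ring (A : comNzRingType) (p : nat)
  of p \in [pchar A] & nat : Type := A.

Section RootRing.
Variables (A : comNzRingType) (p : nat) (charA : p \in [pchar A]) (e : nat).
Local Notation Aq := (root_ring charA e).

HB.instance Definition _ := GRing.ComNzRing.on Aq.

Definition rth_root (x : A) : Aq := x.

Definition root_incl (a : A) : Aq := rth_root (a ^+ (p ^ e)).

Fact root_incl_is_zmod_morphism : zmod_morphism root_incl.
Proof.
move=> x y; rewrite /root_incl /rth_root.
elim: e => [|n IHn]; first by rewrite expn0 !expr1.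
by rewrite expnSr !exprM IHn -!(pFrobenius_autE charA)
  (pFrobenius_autB_comm _ (mulrC _ _)).
Qed.

Fact root_incl_is_monoid_morphism : monoid_morphism root_incl.
Proof. by split=> [|x y]; rewrite /root_incl ?expr1n ?exprMn. Qed.

HB.instance Definition _ :=
  GRing.isZmodMorphism.Build A Aq root_incl root_incl_is_zmod_morphism.
HB.instance Definition _ :=
  GRing.isMonoidMorphism.Build A Aq root_incl root_incl_is_monoid_morphism.

Definition root_scale (a : A) (y : Aq) : Aq := root_incl a * y.

Fact root_scaleA a b y : root_scale a (root_scale b y) = root_scale (a * b) y.
Proof. by rewrite /root_scale rmorphM mulrA. Qed.
Fact root_scale1 : left_id 1 root_scale.
Proof. by move=> y; rewrite /root_scale rmorph1 mul1r. Qed.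
Fact root_scaleDr : right_distributive root_scale +%R.
Proof. by move=> a x y; rewrite /root_scale mulrDr. Qed.
Fact root_scaleDl y : {morph root_scale^~ y : a b / a + b}.
Proof. by move=> a b; rewrite /root_scale rmorphD mulrDl. Qed.

HB.instance Definition _ := GRing.Zmodule_isLmodule.Build A Aq
  root_scaleA root_scale1 root_scaleDr root_scaleDl.

Fact root_scaleAl (a : A) (x y : Aq) : a *: (x * y) = a *: x * y.
Proof. exact: mulrA. Qed.

HB.instance Definition _ := GRing.Lmodule_isLalgebra.Build A Aq root_scaleAl.

Lemma rth_rootK (x : A) : rth_root x ^+ (p ^ e) = root_incl x.
Proof. by []. Qed.

Lemma rth_root_surj (y : Aq) : exists x : A, y = rth_root x.
Proof. by exists y. Qed.

Lemma root_incl_inj : radical_ideal [set 0 : A] -> injective root_incl.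
Proof.
move=> redA x y /eqP; rewrite -subr_eq0 -rmorphB => /eqP xy0.
by apply/eqP; rewrite -subr_eq0; apply/eqP/(redA _ (p ^ e)%N).
Qed.

(* The A-linear map A -> A^{1/q} sending 1 to x^{1/q} has an A-linear left
   inverse. *)
Definition root_splits (x : A) : Prop :=
  exists g : {linear Aq -> A^o}, forall a : A, g (a *: rth_root x) = a.

End RootRing.

Definition F_finite (A : comNzRingType) (p : nat) (charA : p \in [pchar A]) :=
  exists s : seq (root_ring charA 1), forall y : root_ring charA 1,
  exists c : nat -> A, y = \sum_(i < size s) c i *: s`_i.

(* [A°] *)
Definition off_minimal_primes (A : comNzRingType) (c : A) : Prop :=
  forall P : set A, minimal_prime_of [set 0] P -> ~ P c.

Section Pairs.
Variables (K : realType) (A : comNzRingType).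
Variables (p : nat) (charA : p \in [pchar A]).

(* The list of pairs (b_i, s_i) encodes the formal product
   b_1^{s_1} ... b_n^{s_n}; the exponents are meant to be positive, so that
   [Num.truncn] below is the floor. *)
Implicit Type b : seq (set A * K).

Definition pair_power b (q : nat) : set A :=
  \big[ideal_mul/setT]_(x <- b)
     ideal_exp x.1 (Num.truncn (x.2 * (q - 1)%:R)).

Definition pair_product b : set A := \big[ideal_mul/setT]_(x <- b) x.1.

Definition F_pure b : Prop :=
  exists q0 : nat, forall e : nat, (0 < e)%N -> (q0 <= p ^ e)%N ->
  exists2 d, pair_power b (p ^ e) d & root_splits charA e d.

Definition strongly_F_regular b : Prop :=
  forall c : A, off_minimal_primes c ->
  exists2 e : nat, (0 < e)%N &
  exists2 d, pair_power b (p ^ e) d & root_splits charA e (c * d).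

Definition purely_F_regular b : Prop :=
  forall c : A, off_minimal_primes c ->
  (forall P, minimal_prime_of (pair_product b) P -> ~ P c) ->
  exists q0 : nat, forall e : nat, (0 < e)%N -> (q0 <= p ^ e)%N ->
  exists2 d, pair_power b (p ^ e) d & root_splits charA e (c * d).

End Pairs.

Definition quot_map (R : comNzRingType) (I : idealr R) :
  R -> {ideal_quot I} := \pi_{ideal_quot I}.

Lemma pchar_quot (R : comNzRingType) (I : idealr R) (p : nat) :
  p \in [pchar R] -> p \in [pchar {ideal_quot I}].
Proof. exact: (rmorph_pchar (\pi_{ideal_quot I})). Qed.

(* Main.v *)
Require Import Defs.
From HB Require Import structures.
From mathcomp Require Import all_boot all_order all_algebra.
From mathcomp Require Import all_classical reals.
From mathcomp Require Import ring lra zify.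

Set Implicit Arguments.
Unset Strict Implicit.
Unset Printing Implicit Defensive.

Import Order.TTheory GRing.Theory Num.Theory.
Local Open Scope classical_set_scope.
Local Open Scope ring_scope.

(** Write [q = p^e].  An [R]-linear map from [R^{1/q}] to [R] is an additive map [f] on
    [R] with [f (a^q y) = a f(y)], and [d^{1/q} R -> R^{1/q}] splits if and only if some
    such [f] has [f d = 1].  As [R^{1/q}] is free over [R] (Kunz's theorem,
    [regular_frob_basis]), these maps on [S = R/I] are exactly the ones induced by maps
    on [R] that preserve [I] ([frob_lift], [frob_descend]).  The theorem compares the
    maps preserving [I] with the powers of [I].

    From [S] to [R].  The dual of [R^{1/q}] is free over [R^{1/q}]
    ([regular_dual_basis]), so that a map preserving [I] is a combination of maps
    [psi (c _)] with [c] in [I^{[q]} : I].  This colon is contained in [I^q : I], and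
    [I^{k+1} : I = I^k] for all large [k], because the Rees algebra of [I] is noetherian
    ([colon_exp]).  So [c] lies in [I^{q-1}], and a splitting of [d] on [S] gives one of
    [c d] on [R], for all large [q] ([fedder_lift]).  For F-purity this is all.  Strong
    F-regularity gives a splitting for a single [q] only; composing it with splittings
    of further Frobenius powers yields all larger ones, after the multiplier has been
    enlarged to make up for the rounding of exponents ([strongly_F_regular_large]).
    Such an enlargement exists because no [a i] lies in a minimal prime of [I]
    ([strongly_F_regular_nsub]).

    From [R] to [S].  Multiplying any map by an element of [I^{h(q-1)}] makes it preserve
    [I] ([power_descends]).  It suffices that it then sends [I] into every minimal prime
    [P] of [I].  By unmixedness [P] has height [h], and [P R_P] is generated by at most
    [h] elements; by the pigeonhole principle [P^{h(q-1)+1}] is locally contained in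
    [P^{[q]}], which every map sends into [P] ([regular_prime_power]).  That [P R_P] has
    only [h] generators is the regularity of [R_P].  It is obtained from flatness of the
    Frobenius, as in Kunz's converse theorem: if [P R_P] needs [n] generators, the
    colength of [P^{[q]}] is at least [q^n] by Lech's lemma, and at most a constant times
    [q^h] because [P] is minimal over [h] elements ([regular_prime_generators]).

    Freeness of [R^{1/q}] and of its dual are instances of one statement: a finitely
    generated module over a regular local ring on which the parameters form a regular
    sequence is free ([regular_module_free]).  It rests on the fact that parameters
    generate prime ideals ([parameters_prime]), which comes from Krull's height theorem
    ([krull_height]).  Localisations are not constructed: [sat P J] is the contraction
    to the ring of the extension of [J] to the local ring at [P], and lengths over that
    ring are measured by chains of elements ([length_ge]). *)

(** * Ideals as sets *)

Section IdealBasics.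
Context {A : comNzRingType}.
Implicit Types (I J M P Q : set A).

Lemma ideal0 J : is_ideal J -> J 0. Proof. by case. Qed.

Lemma idealD J x y : is_ideal J -> J x -> J y -> J (x + y).
Proof. by case=> _ + _; apply. Qed.

Lemma ideal_lmul J a x : is_ideal J -> J x -> J (a * x).
Proof. by case=> _ _; apply. Qed.

Lemma ideal_rmul J a x : is_ideal J -> J x -> J (x * a).
Proof. by rewrite mulrC; exact: ideal_lmul. Qed.

Lemma idealN J x : is_ideal J -> J x -> J (- x).
Proof. by move=> iJ Jx; rewrite -mulN1r; exact: ideal_lmul. Qed.

Lemma idealB J x y : is_ideal J -> J x -> J y -> J (x - y).
Proof. by move=> iJ Jx Jy; apply: idealD => //; exact: idealN. Qed.

Lemma ideal_sum J (T : Type) (r : seq T) (C : pred T) (F : T -> A) :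
  is_ideal J -> (forall i, C i -> J (F i)) -> J (\sum_(i <- r | C i) F i).
Proof.
by move=> iJ JF; elim/big_ind: _ => //; [exact: ideal0|move=> *; exact: idealD].
Qed.

Lemma ideal_subr J x y : is_ideal J -> J x -> J (x + y) -> J y.
Proof. by move=> iJ Jx Jxy; rewrite -(addKr x y) addrC; exact: idealB. Qed.

Lemma ideal_setT : is_ideal [set: A]. Proof. by []. Qed.

Lemma ideal_set0 : is_ideal [set 0 : A].
Proof.
by split=> // [x y /= -> ->|a x /= ->]; rewrite ?addr0 ?mulr0.
Qed.

Lemma ideal_of_idealr (I : idealr A) : is_ideal [set` I].
Proof.
split=> /= [|x y Ix Iy|a x Ix]; [exact: rpred0|exact: rpredD|].
exact: idealMr.
Qed.

Lemma ideal_gen_ideal X : is_ideal (@ideal_gen A X).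
Proof.
split=> [J [iJ _]|x y gx gy J JX|a x gx J JX]; first exact: ideal0.
- by apply: idealD (gx _ JX) (gy _ JX); case: JX.
- by apply: ideal_lmul (gx _ JX); case: JX.
Qed.

Lemma sub_ideal_gen X : X `<=` @ideal_gen A X.
Proof. exact: sub_gen_smallest. Qed.

Lemma ideal_gen_sub X J : is_ideal J -> X `<=` J -> ideal_gen X `<=` J.
Proof. exact: smallest_sub. Qed.

Lemma ideal_gen_id J : is_ideal J -> ideal_gen J = J.
Proof. exact: smallest_id. Qed.

Lemma ideal_gen_seqE (s : seq A) :
  ideal_gen [set` s] =
  [set x | exists c : nat -> A, x = \sum_(i < size s) c i * s`_i].
Proof.
apply/seteqP; split.
  apply: ideal_gen_sub; last first.
    move=> x /= xs; exists (fun i => (i == index x s)%:R).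
    have xs' := xs; rewrite -index_mem in xs'.
    rewrite (bigD1 (Ordinal xs')) //= eqxx mul1r nth_index // big1 ?addr0 //.
    by move=> i; rewrite -val_eqE /= => /negbTE ->; rewrite mul0r.
  split=> [|x y [c ->] [d ->]|a x [c ->]].
  - by exists (fun=> 0); rewrite big1 // => i _; rewrite mul0r.
  - exists (fun i => c i + d i); rewrite -big_split; apply: eq_bigr => i _.
    by rewrite mulrDl.
  - exists (fun i => a * c i); rewrite big_distrr; apply: eq_bigr => i _ /=.
    by rewrite mulrA.
move=> _ [c ->]; apply: ideal_sum => [|i _]; first exact: ideal_gen_ideal.
apply: (ideal_lmul _ (@ideal_gen_ideal _)).
by apply: sub_ideal_gen => /=; rewrite mem_nth.
Qed.

(** The ideals [J + (x)] and [J : x]. *)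
Definition ideal_adj J (x : A) : set A := [set y | exists a, J (y - a * x)].

Definition ideal_colon J (x : A) : set A := [set y | J (y * x)].

Lemma ideal_adj_ideal J x : is_ideal J -> is_ideal (ideal_adj J x).
Proof.
move=> iJ; split=> [|y z [a Ja] [b Jb]|c y [a Ja]].
- by exists 0; rewrite mul0r subr0; exact: ideal0.
- exists (a + b); rewrite mulrDl opprD addrACA; exact: idealD.
- by exists (c * a); rewrite -mulrA -mulrBr; exact: ideal_lmul.
Qed.

Lemma sub_ideal_adj J x : J `<=` ideal_adj J x.
Proof. by move=> y Jy; exists 0; rewrite mul0r subr0. Qed.

Lemma ideal_adj_mem J x : is_ideal J -> ideal_adj J x x.
Proof. by move=> iJ; exists 1; rewrite mul1r subrr; exact: ideal0. Qed.

Lemma ideal_adj_sub J x M : is_ideal M -> J `<=` M -> M x -> ideal_adj J x `<=` M.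
Proof.
move=> iM JM Mx y [a /JM Ma]; rewrite -(subrK (a * x) y).
by apply: idealD => //; exact: ideal_lmul.
Qed.

Lemma ideal_colon_ideal J x : is_ideal J -> is_ideal (ideal_colon J x).
Proof.
move=> iJ; rewrite /ideal_colon; split=> /= [|y z Jy Jz|c y Jy].
- by rewrite mul0r; exact: ideal0.
- by rewrite mulrDl; exact: idealD.
- by rewrite -mulrA; exact: ideal_lmul.
Qed.

Lemma sub_ideal_colon J x : is_ideal J -> J `<=` ideal_colon J x.
Proof. by move=> iJ y Jy; exact: ideal_rmul. Qed.

Lemma ideal_gen_cons x (s : seq A) :
  ideal_gen [set` x :: s] = ideal_adj (ideal_gen [set` s]) x.
Proof.
have iG := @ideal_gen_ideal [set` s].
apply/seteqP; split.
  apply: ideal_gen_sub; first exact: ideal_adj_ideal.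
  move=> y /=; rewrite inE => /orP[/eqP ->|ys]; first exact: ideal_adj_mem.
  by apply: sub_ideal_adj; apply: sub_ideal_gen.
apply: ideal_adj_sub; first exact: ideal_gen_ideal.
  apply: ideal_gen_sub => [|y ys]; first exact: ideal_gen_ideal.
  by apply: sub_ideal_gen; rewrite /= inE ys orbT.
by apply: sub_ideal_gen; rewrite /= inE eqxx.
Qed.

Lemma ideal_gen_nil : ideal_gen [set` [::] : seq A] = [set 0].
Proof.
apply/seteqP; split; first by apply: ideal_gen_sub => //; exact: ideal_set0.
by move=> _ ->; apply: ideal0; exact: ideal_gen_ideal.
Qed.

(** ** Products and powers of ideals *)

Lemma ideal_mul_ideal I J : is_ideal (ideal_mul I J).
Proof. exact: ideal_gen_ideal. Qed.

Lemma ideal_mulP I J x y : I x -> J y -> ideal_mul I J (x * y).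
Proof. by move=> Ix Jy; apply: sub_ideal_gen; exists x, y. Qed.

Lemma ideal_mul_ind I J M : is_ideal M ->
  (forall x y, I x -> J y -> M (x * y)) -> ideal_mul I J `<=` M.
Proof. by move=> iM H; apply: ideal_gen_sub => // _ [x [y [Ix Jy ->]]]; exact: H. Qed.

Lemma ideal_mul_sub I J I' J' : I `<=` I' -> J `<=` J' ->
  ideal_mul I J `<=` ideal_mul I' J'.
Proof.
move=> II' JJ'; apply: ideal_mul_ind => [|x y Ix Jy]; first exact: ideal_mul_ideal.
by apply: ideal_mulP; [exact: II'|exact: JJ'].
Qed.

Lemma ideal_mul_subl I J : is_ideal I -> ideal_mul I J `<=` I.
Proof. by move=> iI; apply: ideal_mul_ind => // x y Ix _; exact: ideal_rmul. Qed.

Lemma ideal_mul_subr I J : is_ideal J -> ideal_mul I J `<=` J.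
Proof. by move=> iJ; apply: ideal_mul_ind => // x y _ Jy; exact: ideal_lmul. Qed.

Lemma ideal_exp_ideal J n : is_ideal (ideal_exp J n).
Proof. by case: n => [|n]; [exact: ideal_setT|exact: ideal_mul_ideal]. Qed.

Lemma ideal_expS J n : ideal_exp J n.+1 = ideal_mul J (ideal_exp J n).
Proof. by []. Qed.

Lemma ideal_expX J n x : J x -> ideal_exp J n (x ^+ n).
Proof. by move=> Jx; elim: n => // n IHn; rewrite exprS; exact: ideal_mulP. Qed.

Lemma ideal_exp1 J x : J x -> ideal_exp J 1 x.
Proof. by move=> Jx; rewrite -(mulr1 x); exact: ideal_mulP. Qed.

Lemma ideal_expD J k l x y :
  ideal_exp J k x -> ideal_exp J l y -> ideal_exp J (k + l) (x * y).
Proof.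
elim: k x => [|k IHk] x.
  by move=> _ Jy; apply: ideal_lmul => //; exact: ideal_exp_ideal.
move=> Jx Jy; suff: ideal_exp J k.+1 `<=` ideal_colon (ideal_exp J (k.+1 + l)) y.
  exact.
apply: ideal_mul_ind => [|u v Ju Jv].
  exact/ideal_colon_ideal/ideal_exp_ideal.
by rewrite /ideal_colon /= -mulrA; apply: ideal_mulP => //; exact: IHk.
Qed.

Lemma ideal_exp_le J k l : (l <= k)%N -> ideal_exp J k `<=` ideal_exp J l.
Proof.
elim: k => [|k IHk]; first by rewrite leqn0 => /eqP ->.
rewrite leq_eqVlt ltnS => /predU1P[->//|lk].
apply: (subset_trans _ (IHk lk)); apply: ideal_mul_subr; exact: ideal_exp_ideal.
Qed.

Lemma ideal_exp_sub J n : is_ideal J -> (0 < n)%N -> ideal_exp J n `<=` J.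
Proof. by case: n => // n iJ _; exact: ideal_mul_subl. Qed.

(** Meant for factors that are powers of ideals, whose exponents add up. *)
Lemma ideal_mul_bigP (T : eqType) (r : seq T) (F G H : T -> set A) x y :
  (forall i u v, i \in r -> F i u -> G i v -> H i (u * v)) ->
  (\big[ideal_mul/setT]_(i <- r) F i) x ->
  (\big[ideal_mul/setT]_(i <- r) G i) y ->
  (\big[ideal_mul/setT]_(i <- r) H i) (x * y).
Proof.
elim: r x y => [|i r IHr] x y FGH; first by rewrite !big_nil.
rewrite !big_cons => Fx Gy.
have iH : is_ideal (ideal_mul (H i) (\big[ideal_mul/setT]_(j <- r) H j)).
  exact: ideal_mul_ideal.
suff: ideal_mul (F i) (\big[ideal_mul/setT]_(j <- r) F j) `<=`
  ideal_colon (ideal_mul (H i) (\big[ideal_mul/setT]_(j <- r) H j)) y by exact.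
apply: ideal_mul_ind => [|u v Fu Fv]; first exact: ideal_colon_ideal.
suff: ideal_mul (G i) (\big[ideal_mul/setT]_(j <- r) G j) `<=`
  ideal_colon (ideal_mul (H i) (\big[ideal_mul/setT]_(j <- r) H j)) (u * v).
  by move=> /(_ _ Gy); rewrite /ideal_colon /= mulrC.
apply: ideal_mul_ind => [|u' v' Gu Gv]; first exact: ideal_colon_ideal.
rewrite /ideal_colon /= mulrACA; apply: ideal_mulP.
  by rewrite mulrC; apply: FGH; rewrite ?mem_head.
rewrite mulrC; apply: IHr => // j a b jr; apply: FGH.
by rewrite inE jr orbT.
Qed.

Lemma ideal_mul_big_sub (T : eqType) (r : seq T) (F G : T -> set A) :
  (forall i, i \in r -> F i `<=` G i) ->
  \big[ideal_mul/setT]_(i <- r) F i `<=` \big[ideal_mul/setT]_(i <- r) G i.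
Proof.
elim: r => [|i r IHr] FG; first by rewrite !big_nil.
rewrite !big_cons; apply: ideal_mul_sub; first by apply: FG; rewrite mem_head.
by apply: IHr => j jr; apply: FG; rewrite inE jr orbT.
Qed.

Lemma ideal_mul_big_ideal (T : Type) (r : seq T) (F : T -> set A) :
  is_ideal (\big[ideal_mul/setT]_(i <- r) F i).
Proof.
by case: r => [|i r]; rewrite ?big_nil ?big_cons;
  [exact: ideal_setT|exact: ideal_mul_ideal].
Qed.

Lemma ideal_mul_big_le (T : eqType) (r : seq T) (F : T -> set A) i :
  (forall j, j \in r -> is_ideal (F j)) -> i \in r ->
  \big[ideal_mul/setT]_(j <- r) F j `<=` F i.
Proof.
elim: r => // j r IHr iF; rewrite inE big_cons => /predU1P[->|ir].
  by apply: ideal_mul_subl; apply: iF; rewrite mem_head.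
apply: (subset_trans (ideal_mul_subr _)); first exact: ideal_mul_big_ideal.
by apply: IHr => // k kr; apply: iF; rewrite inE kr orbT.
Qed.

(** ** Primes *)

Lemma prime_ideal P : is_prime P -> is_ideal P. Proof. by case. Qed.

Lemma primeN1 P : is_prime P -> ~ P 1. Proof. by case. Qed.

Lemma primeM P x y : is_prime P -> P (x * y) -> P x \/ P y.
Proof. by case=> _ _; apply. Qed.

Lemma primeMN P x y : is_prime P -> ~ P x -> ~ P y -> ~ P (x * y).
Proof. by move=> pP nx ny /(primeM pP)[]. Qed.

Lemma primeXN P x n : is_prime P -> ~ P x -> ~ P (x ^+ n).
Proof.
move=> pP nx; elim: n => [|n IHn]; first by rewrite expr0; exact: primeN1.
by rewrite exprS; exact: primeMN.
Qed.

Lemma primeX P x n : is_prime P -> P (x ^+ n) -> P x.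
Proof. by move=> pP Px; apply: contrapT => nx; exact: primeXN Px. Qed.

Lemma prime_mul_sub P I J : is_prime P -> ideal_mul I J `<=` P ->
  I `<=` P \/ J `<=` P.
Proof.
move=> pP IJP; have [|/existsNP[x /not_implyP[Ix nPx]]] := pselect (I `<=` P).
  by left.
by right=> y Jy; have [|//] := primeM pP (IJP _ (ideal_mulP Ix Jy)).
Qed.

Lemma prime_exp_sub P J n : is_prime P -> ideal_exp J n `<=` P -> J `<=` P.
Proof. by move=> pP JP x Jx; apply: primeX pP (JP _ (ideal_expX n Jx)). Qed.

Lemma prime_big_sub (T : eqType) (r : seq T) P (F : T -> set A) : is_prime P ->
  \big[ideal_mul/setT]_(i <- r) F i `<=` P -> exists2 i, i \in r & F i `<=` P.
Proof.
move=> pP; elim: r => [|i r IHr]; first by rewrite big_nil => /(_ 1 I) /primeN1.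
rewrite big_cons => /(prime_mul_sub pP)[FP|/IHr[j jr FP]].
  by exists i => //; rewrite mem_head.
by exists j => //; rewrite inE jr orbT.
Qed.

Lemma maximal_prime M : is_maximal M -> is_prime M.
Proof.
move=> [iM M1 maxM]; split=> // x y Mxy; apply: contrapT => /not_orP[nx ny].
have eq1 z : ~ M z -> ideal_adj M z 1.
  move=> nz; apply: contrapT => n1; apply: nz.
  have <- := maxM _ (ideal_adj_ideal z iM) n1 (@sub_ideal_adj M z).
  exact: ideal_adj_mem.
have [a Ma] := eq1 _ nx; have [b Mb] := eq1 _ ny; apply: M1.
have -> : 1 = (1 - a * x) + (1 - b * y) * (a * x) + (a * b) * (x * y) by ring.
apply: idealD => //; last exact: ideal_lmul.
by apply: idealD => //; exact: ideal_rmul.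
Qed.

End IdealBasics.

(** Zorn's lemma applies because the union of a chain of ideals, being finitely
    generated, is a member of the chain. *)
Lemma noetherian_max (A : comNzRingType) (F : set (set A)) (J : set A) :
  noetherian A -> (forall M, F M -> is_ideal M) -> F J ->
  exists2 M, F M & J `<=` M /\ forall M', F M' -> M `<=` M' -> M' = M.
Proof.
move=> noeA iF FJ.
(* The empty set is let in as the union of the empty chain. *)
pose P : set (set A) := [set X | X = set0 \/ F X /\ J `<=` X].
have [|M [PM maxM]] := @Zorn_bigcup A P.
  move=> G GP totG.
  have [[X0 GX0 [x0 X0x0]]|noX] := pselect (exists2 X, G X & X !=set0); last first.
    left; apply/seteqP; split=> // x [X GX Xx]; apply: noX; exists X => //.
    by exists x.
  have GF X x : G X -> X x -> F X /\ J `<=` X.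
    by move=> GX Xx; have [X0'|//] := GP _ GX; move: Xx; rewrite X0'.
  right; have JU : J `<=` \bigcup_(X in G) X.
    by move=> x Jx; exists X0 => //; apply: (GF _ _ GX0 X0x0).2.
  split=> //; have iU : is_ideal (\bigcup_(X in G) X).
    split=> [|x y [X GX Xx] [Y GY Yy]|a x [X GX Xx]].
    - by apply: JU; apply: ideal0; exact: iF.
    - have [XY|YX] := totG _ _ GX GY.
        exists Y => //; apply: idealD => //; last exact: XY.
        by apply: iF; case: (GF _ _ GY Yy).
      exists X => //; apply: idealD => //; last exact: YX.
      by apply: iF; case: (GF _ _ GX Xx).
    - by exists X => //; apply: ideal_lmul => //; by apply: iF; case: (GF _ _ GX Xx).
  have [s sE] := noeA _ iU.
  have : [set` s] `<=` \bigcup_(X in G) X by rewrite sE; exact: sub_ideal_gen.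
  suff: [set` s] `<=` \bigcup_(X in G) X -> exists2 X, G X & X x0 /\ [set` s] `<=` X.
    move=> /[apply] -[X GX [Xx sX]].
    suff -> : \bigcup_(X in G) X = X by case: (GF _ _ GX Xx).
    apply/seteqP; split=> [|y Xy]; last by exists X.
    by rewrite sE; apply: ideal_gen_sub => //; apply: iF; case: (GF _ _ GX Xx).
  elim: s {sE} => [|x s IHs] sub; first by exists X0.
  have [|X GX [Xx0 sX]] := IHs.
    by move=> y /= ys; apply: sub; rewrite /= inE ys orbT.
  have [|Y GY Yx] := sub x; first by rewrite /= mem_head.
  have [XY|YX] := totG _ _ GX GY.
    exists Y => //; split; first exact: XY.
    by move=> y /=; rewrite inE => /predU1P[->//|/sX /XY].
  exists X => //; split=> // y /=; rewrite inE => /predU1P[->|/sX//].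
  exact: YX.
case: PM => [M0|[FM JM]].
  exfalso; apply: (maxM J); last by right; split.
  rewrite M0; split=> // J0; exact: J0 (ideal0 (iF _ FJ)).
exists M => //; split=> // M' FM' MM'; apply: contrapT => neq.
apply: (maxM M'); last by right; split=> //; exact: subset_trans JM MM'.
by split=> // M'M; apply: neq; apply/seteqP.
Qed.

(** * Primes of a noetherian ring *)

Section NoetherianPrimes.
Context {A : comNzRingType}.
Hypothesis noeA : noetherian A.
Implicit Types (I J K M P Q : set A).

(** An ideal maximal among those that contain [J] and avoid [T] is prime. *)
Lemma prime_disjoint_mult (T J : set A) : is_ideal J -> T 1 ->
  (forall x y, T x -> T y -> T (x * y)) -> (forall x, J x -> ~ T x) ->
  exists2 Q, is_prime Q & J `<=` Q /\ forall x, Q x -> ~ T x.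
Proof.
move=> iJ T1 TM JT.
pose F := [set Q | is_ideal Q /\ forall x, Q x -> ~ T x].
have [//|Q [iQ QT] [JQ maxQ]] := @noetherian_max A F J noeA _ (conj iJ JT).
  by move=> ? [].
have meet x : ~ Q x -> exists2 t, T t & ideal_adj Q x t.
  move=> nQx; apply: contrapT => no; apply: nQx.
  rewrite -(maxQ (ideal_adj Q x)); first exact: ideal_adj_mem.
    split; first exact: ideal_adj_ideal.
    by move=> y Qy Ty; apply: no; exists y.
  exact: sub_ideal_adj.
exists Q => //; split=> //; first by move=> /QT.
move=> x y Qxy; apply: contrapT => /not_orP[/meet[t Tt [a Qa]] /meet[u Tu [b Qb]]].
apply: (QT (t * u)); last exact: TM.
have -> : t * u = u * (t - a * x) + (a * x) * (u - b * y) + (a * b) * (x * y).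
  by ring.
by apply: idealD => //; [apply: idealD => //|]; exact: ideal_lmul.
Qed.

Lemma radical_primeP J x : is_ideal J -> radical_ideal J ->
  (forall Q, is_prime Q -> J `<=` Q -> Q x) -> J x.
Proof.
move=> iJ rJ allQ; apply: contrapT => nJx.
have [||||Q pQ [JQ QT]] := @prime_disjoint_mult [set y | exists n, y = x ^+ n] J.
- by [].
- by exists 0%N.
- by move=> _ _ [k ->] [l ->]; exists (k + l)%N; rewrite exprD.
- by move=> y Jy [n yE]; apply: nJx; apply: (rJ _ n); rewrite -yE.
- by apply: (QT x); [exact: allQ|exists 1%N; rewrite expr1].
Qed.

(** Otherwise some prime containing [J] would avoid all the [s * x ^+ n] with [s]
    outside [P], and lie strictly below [P]. *)
Lemma minimal_prime_nilpotent J P x : is_ideal J -> minimal_prime_of J P ->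
  P x -> exists n, exists2 s, ~ P s & J (s * x ^+ n).
Proof.
move=> iJ [pP JP minP] Px; apply: contrapT => no.
pose T := [set y | exists n, exists2 s, ~ P s & y = s * x ^+ n].
have [||||Q pQ [JQ QT]] := @prime_disjoint_mult T J.
- by [].
- by exists 0%N, 1; [exact: primeN1|rewrite mulr1].
- move=> _ _ [k [s ns ->]] [l [t nt ->]]; exists (k + l)%N, (s * t).
    exact: primeMN.
  by rewrite exprD mulrACA.
- by move=> y Jy [n [s ns yE]]; apply: no; exists n, s => //; rewrite -yE.
have QP : Q = P.
  apply: minP => // y Qy; apply: contrapT => nPy; apply: (QT y Qy).
  by exists 0%N, y => //; rewrite mulr1.
by apply: (QT x); [rewrite QP|exists 1%N, 1; [exact: primeN1|rewrite mul1r]].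
Qed.

Lemma seq_subset_minimal (l : seq (set A)) Q : Q \in l ->
  exists2 Q', Q' \in l & Q' `<=` Q /\
    forall Q'', Q'' \in l -> Q'' `<=` Q' -> Q'' = Q'.
Proof.
have [n] := ubnP (size l); elim: n l Q => // n IHn l Q; rewrite ltnS => ln Ql.
have [minQ|] := pselect (forall Q'', Q'' \in l -> Q'' `<=` Q -> Q'' = Q).
  by exists Q => //; split.
move=> /existsNP[Q2 /not_implyP[Q2l /not_implyP[Q2Q Q2neq]]].
pose l' := [seq X <- l | `[< X `<=` Q /\ X <> Q >]].
have [||Q' + [Q'Q minQ']] := IHn l' Q2.
- apply: leq_trans ln; rewrite size_filter -(count_predC (mem [:: Q]) l).
  have : (0 < count (mem [:: Q]) l)%N.
    by rewrite -has_count; apply/hasP; exists Q; rewrite //= inE.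
  set c := count (predC _) _ => cpos.
  suff : (count (fun X => `[< X `<=` Q /\ X <> Q >]) l <= c)%N by lia.
  apply: sub_count => X /= /asboolP[_ nX]; rewrite inE; apply/negP.
  by move=> /eqP.
- by rewrite mem_filter Q2l andbT; apply/asboolP.
rewrite mem_filter => /andP[/asboolP[_ Q'neq] Q'l].
exists Q' => //; split; first exact: subset_trans _ Q2Q.
move=> X Xl XQ'; apply: minQ' => //; rewrite mem_filter Xl andbT; apply/asboolP.
split; first by apply: subset_trans XQ' _; exact: subset_trans _ Q2Q.
move=> XQ; apply: Q2neq; apply/seteqP; split => //.
by rewrite -XQ; exact: subset_trans _ Q'Q.
Qed.

(** Noetherian induction: if [x * y] lies in a maximal counterexample [M] and its
    factors do not, the lists for [M + (x)] and [M + (y)] together serve [M]. *)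
Lemma noetherian_minimal_primes J : is_ideal J ->
  exists2 l : seq (set A), (forall P, P \in l -> minimal_prime_of J P) &
    forall Q, is_prime Q -> J `<=` Q -> exists2 P, P \in l & P `<=` Q.
Proof.
move=> iJ.
suff [l lP lQ] : exists2 l : seq (set A),
    (forall P, P \in l -> is_prime P /\ J `<=` P) &
    forall Q, is_prime Q -> J `<=` Q -> exists2 P, P \in l & P `<=` Q.
  exists [seq P <- l | `[< minimal_prime_of J P >]].
    by move=> P; rewrite mem_filter => /andP[/asboolP].
  move=> Q pQ JQ; have [Q1 Q1l Q1Q] := lQ _ pQ JQ.
  have [P Pl [PQ1 minP]] := seq_subset_minimal Q1l.
  exists P; last exact: subset_trans _ Q1Q.
  rewrite mem_filter Pl andbT; apply/asboolP; have [pP JP] := lP _ Pl.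
  split=> // X pX JX XP; have [Y Yl YX] := lQ _ pX JX.
  by have YP := minP _ Yl (subset_trans YX XP); apply/seteqP; split=> //; rewrite -YP.
apply: contrapT => noJ.
pose F := [set J : set A | is_ideal J /\ ~ exists2 l : seq (set A),
    (forall P, P \in l -> is_prime P /\ J `<=` P) &
    forall Q, is_prime Q -> J `<=` Q -> exists2 P, P \in l & P `<=` Q].
have [|M [iM noM] [_ maxM]] := @noetherian_max A F J noeA _ (conj iJ noJ).
  by move=> ? [].
apply: (noM); have [M1|nM1] := pselect (M 1).
  by exists [::] => // Q pQ MQ; case: (primeN1 pQ); exact: MQ.
have [pM|npM] := pselect (is_prime M).
  by exists [:: M] => [P|Q _ MQ]; [rewrite inE => /eqP->; split|exists M; rewrite ?mem_head].
have : exists x y, [/\ M (x * y), ~ M x & ~ M y].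
  apply: contrapT => no; apply: npM; split=> // x y Mxy.
  by apply: contrapT => /not_orP[nx ny]; apply: no; exists x, y.
move=> [x [y [Mxy nx ny]]].
have cov z : ~ M z -> exists2 l : seq (set A),
    (forall P, P \in l -> is_prime P /\ M `<=` P) &
    forall Q, is_prime Q -> M `<=` Q -> Q z -> exists2 P, P \in l & P `<=` Q.
  move=> nz; apply: contrapT => no; apply: nz.
  rewrite -(maxM (ideal_adj M z)); first exact: ideal_adj_mem.
    split; first exact: ideal_adj_ideal.
    move=> [l lP lQ]; apply: no; exists l.
      by move=> P /lP[pP MP]; split=> //; apply: subset_trans _ MP; exact: sub_ideal_adj.
    by move=> Q pQ MQ Qz; apply: lQ => //; apply: ideal_adj_sub => //; exact: prime_ideal.
  exact: sub_ideal_adj.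
have [lx lxP lxQ] := cov _ nx; have [ly lyP lyQ] := cov _ ny.
exists (lx ++ ly) => [P|Q pQ MQ].
  by rewrite mem_cat => /orP[/lxP|/lyP].
have [Qx|Qy] := primeM pQ (MQ _ Mxy).
  by have [P Pl PQ] := lxQ _ pQ MQ Qx; exists P; rewrite // mem_cat Pl.
by have [P Pl PQ] := lyQ _ pQ MQ Qy; exists P; rewrite // mem_cat Pl orbT.
Qed.

(** Prime avoidance for the coset [x + K].  If [x + z] falls into the new prime
    [Q], it is corrected by a multiple of elements of the earlier primes that are
    not below [Q]; the primes below [Q] are avoided as soon as [Q] is. *)
Lemma prime_avoidance K x (l : seq (set A)) : is_ideal K ->
  (forall Q, Q \in l -> is_prime Q) ->
  (forall Q, Q \in l -> ~ (Q x /\ K `<=` Q)) ->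
  exists2 z, K z & forall Q, Q \in l -> ~ Q (x + z).
Proof.
move=> iK; elim: l => [|Q l IHl] pl avl; first by exists 0; [exact: ideal0|].
have [||z Kz avz] := IHl.
- by move=> Q' Q'l; apply: pl; rewrite inE Q'l orbT.
- by move=> Q' Q'l; apply: avl; rewrite inE Q'l orbT.
have pQ : is_prime Q by apply: pl; rewrite mem_head.
have iQ := prime_ideal pQ.
have [Qxz|nQxz] := pselect (Q (x + z)); last first.
  by exists z => // Q'; rewrite inE => /predU1P[->|/avz].
have [k Kk nQk] : exists2 k, K k & ~ Q k.
  apply: contrapT => no; apply: (avl Q); first by rewrite mem_head.
  have KQ : K `<=` Q.
    by move=> k Kk; apply: contrapT => nQk; apply: no; exists k.
  by split=> //; rewrite -(addrK z x); apply: idealB => //; exact: KQ.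
have [w nQw ww] : exists2 w, ~ Q w & forall Q', Q' \in l -> ~ (Q' `<=` Q) -> Q' w.
  elim: l pl {IHl avl avz} => [|Q1 l IHl] pl; first by exists 1 => //; exact: primeN1.
  have [|w nQw ww] := IHl.
    by move=> Q'; rewrite inE => /orP[Q'l|Q'l]; apply: pl; rewrite !inE Q'l ?orbT.
  have iQ1 : is_ideal Q1 by apply: prime_ideal; apply: pl; rewrite !inE eqxx orbT.
  have iQl Q' : Q' \in l -> is_ideal Q'.
    by move=> Q'l; apply: prime_ideal; apply: pl; rewrite !inE Q'l !orbT.
  have [Q1Q|/existsNP[u /not_implyP[Q1u nQu]]] := pselect (Q1 `<=` Q).
    by exists w => // Q'; rewrite inE => /predU1P[->//|]; exact: ww.
  exists (u * w); first exact: primeMN.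
  move=> Q'; rewrite inE => /predU1P[->_|Q'l nQ']; first exact: ideal_rmul.
  by apply: ideal_lmul; [exact: iQl|exact: ww].
exists (z + k * w); first by apply: idealD => //; exact: ideal_rmul.
have nQ : ~ Q (x + (z + k * w)).
  by rewrite addrA => /(ideal_subr iQ Qxz); exact: primeMN.
move=> Q'; rewrite inE => /predU1P[->//|Q'l].
have [Q'Q|nQ'Q] := pselect (Q' `<=` Q); first by move/Q'Q.
have iQ' : is_ideal Q' by apply: prime_ideal; apply: pl; rewrite inE Q'l orbT.
have Q'kw : Q' (k * w) by apply: ideal_lmul => //; exact: ww.
by move=> Q'xz; apply: (avz _ Q'l); apply: (ideal_subr iQ' Q'kw); rewrite addrC -addrA.
Qed.

(** ** Localisation at a prime *)

(** [sat P J] is the contraction of [J A_P]. *)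
Definition sat P J : set A := [set x | exists2 s, ~ P s & J (s * x)].

Lemma sat_ideal P J : is_prime P -> is_ideal J -> is_ideal (sat P J).
Proof.
move=> pP iJ; split=> [|x y [s ns Jx] [t nt Jy]|a x [s ns Jx]].
- by exists 1; [exact: primeN1|rewrite mulr0; exact: ideal0].
- exists (s * t); first exact: primeMN.
  rewrite mulrDr; apply: idealD => //.
    by rewrite mulrAC; exact: ideal_rmul.
  by rewrite -mulrA; exact: ideal_lmul.
- by exists s => //; rewrite mulrCA; exact: ideal_lmul.
Qed.

Lemma sub_sat P J : is_prime P -> J `<=` sat P J.
Proof. by move=> pP x Jx; exists 1; [exact: primeN1|rewrite mul1r]. Qed.

Lemma sat_mono P J J' : J `<=` J' -> sat P J `<=` sat P J'.
Proof. by move=> JJ' x [s ns Js]; exists s => //; exact: JJ'. Qed.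

Lemma sat_idem P J : is_prime P -> sat P (sat P J) `<=` sat P J.
Proof.
move=> pP x [s ns [t nt Jst]]; exists (t * s); first exact: primeMN.
by rewrite -mulrA.
Qed.

Lemma sat_sub P J Q : is_prime Q -> J `<=` Q -> Q `<=` P -> sat P J `<=` Q.
Proof.
by move=> pQ JQ QP x [s ns /JQ /(primeM pQ)[/QP|]].
Qed.

(** If [M A_P] were not inside [J A_P], take [N] maximal among the ideals over [J]
    whose localisation does not contain it: [(M + N) A_P / N A_P] is simple, so [P]
    kills it, and Nakayama's lemma follows without using generators. *)
Lemma nakayama P J M : is_prime P -> is_ideal J -> is_ideal M ->
  (forall a, M a -> exists s b, [/\ ~ P s, ideal_mul P M b & J (s * a - b)]) ->
  M `<=` sat P J.
Proof.
move=> pP iJ iM H; apply: contrapT => nMJ; have iP := prime_ideal pP.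
pose F := [set N | [/\ is_ideal N, J `<=` N & ~ (M `<=` sat P N)]].
have [||N [iN JN nMN] [_ maxN]] := @noetherian_max A F J noeA.
- by move=> ? [].
- by split.
move/existsNP: nMN => [a /not_implyP[Ma nNa]].
have MNa : M `<=` sat P (ideal_adj N a).
  apply: contrapT => no; apply: nNa; apply: (sub_sat pP).
  rewrite -(maxN (ideal_adj N a)); first exact: ideal_adj_mem.
    split=> //; first exact: ideal_adj_ideal.
    by apply: subset_trans JN _; exact: sub_ideal_adj.
  exact: sub_ideal_adj.
pose W := [set c | exists s p, [/\ ~ P s, P p & N (s * c - p * a)]].
have PMW : ideal_mul P M `<=` W.
  apply: ideal_mul_ind; last first.
    move=> p x Pp /MNa[s ns [r Nr]]; exists s, (p * r); split=> //.
      exact: ideal_rmul.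
    have -> : s * (p * x) - p * r * a = p * (s * x - r * a) by ring.
    exact: ideal_lmul.
  split=> [|x y [s [u [ns Pu Nx]]] [t [v [nt Pv Ny]]]|c x [s [u [ns Pu Nx]]]].
  - exists 1, 0; split; [exact: primeN1|exact: ideal0|].
    by rewrite mulr0 mul0r subr0; exact: ideal0.
  - exists (s * t), (t * u + s * v); split; first exact: primeMN.
      by apply: idealD => //; exact: ideal_lmul.
    have -> : s * t * (x + y) - (t * u + s * v) * a =
      t * (s * x - u * a) + s * (t * y - v * a) by ring.
    by apply: idealD => //; exact: ideal_lmul.
  - exists s, (c * u); split=> //; first exact: ideal_lmul.
    have -> : s * (c * x) - c * u * a = c * (s * x - u * a) by ring.
    exact: ideal_lmul.
have [t [b [nt /PMW[s [p [ns Pp Nb]]] /JN Nab]]] := H _ Ma.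
apply: nNa; exists (s * t - p).
  move=> Pst; apply: (primeMN pP ns nt); rewrite -(subrK p (s * t)).
  exact: idealD.
have -> : (s * t - p) * a = s * (t * a - b) + (s * b - p * a) by ring.
by apply: idealD => //; exact: ideal_lmul.
Qed.

(** ** Length over the localisation *)

(** [length_ge P J n]: the [A_P]-module [A_P / J A_P] has length at least [n],
    witnessed by a chain of ideals each generated over the previous one by one
    more element. *)
Inductive length_ge P : set A -> nat -> Prop :=
| LengthGe0 J : length_ge P J 0
| LengthGeS J x n : ~ sat P J x -> length_ge P (ideal_adj J x) n ->
    length_ge P J n.+1.

Lemma ideal_adjS J J' x : J `<=` J' -> ideal_adj J x `<=` ideal_adj J' x.
Proof. by move=> JJ' y [a Ja]; exists a; exact: JJ'. Qed.

Lemma length_ge_anti P J J' n : J `<=` J' -> length_ge P J' n -> length_ge P J n.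
Proof.
move=> + L; elim: L J => [J1|J1 x {}n nx _ IH] J JJ1; first exact: LengthGe0.
apply: (@LengthGeS _ _ x); first by move=> /(sat_mono JJ1).
by apply: IH; exact: ideal_adjS.
Qed.

(** The two halves of the additivity of length on
    [0 -> A/(J:y) -> A/J -> A/(J+y) -> 0]. *)
Lemma length_ge_sub P J y n : is_prime P -> is_ideal J -> length_ge P J n ->
  exists a b, [/\ (n <= a + b)%N, length_ge P (ideal_adj J y) a &
                  length_ge P (ideal_colon J y) b].
Proof.
move=> pP + L; elim: L => [J1|J1 x {}n nx _ IH] iJ.
  by exists 0%N, 0%N; split=> //; exact: LengthGe0.
have [a [b [nab La Lb]]] := IH (ideal_adj_ideal _ iJ).
have colonS : ideal_colon J1 y `<=` ideal_colon (ideal_adj J1 x) y.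
  by move=> r Jr; apply: sub_ideal_adj.
have adjS : ideal_adj J1 y `<=` ideal_adj (ideal_adj J1 x) y.
  by apply: ideal_adjS; exact: sub_ideal_adj.
have iC := ideal_colon_ideal y (ideal_adj_ideal x iJ).
have [[s ns [r Jr]]|nJy] := pselect (sat P (ideal_adj J1 y) x); last first.
  exists a.+1, b; split; first by lia.
    apply: (LengthGeS nJy); apply: length_ge_anti La.
    apply: ideal_adj_sub; [|by apply: ideal_adjS; exact: sub_ideal_adj|].
      by do 2!apply: ideal_adj_ideal.
    by apply: sub_ideal_adj; exact: ideal_adj_mem.
  exact: length_ge_anti Lb.
exists a, b.+1; split; [by lia|exact: length_ge_anti La|].
apply: (@LengthGeS _ _ r).
  move=> [t nt Jtr]; apply: nx; exists (t * s); first exact: primeMN.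
  have -> : t * s * x = t * (s * x - r * y) + t * r * y by ring.
  by apply: idealD => //; exact: ideal_lmul.
apply: length_ge_anti Lb; apply: ideal_adj_sub => //.
exists s; have -> : r * y - s * x = - (s * x - r * y) by ring.
exact: idealN.
Qed.

Lemma length_ge_add P J J' y a b : is_prime P -> is_ideal J -> is_ideal J' ->
  (forall r, J (r * y) -> sat P J' r) ->
  length_ge P (ideal_adj J y) a -> length_ge P J' b -> length_ge P J (b + a).
Proof.
move=> pP iJ + + La Lb; elim: Lb J iJ La => [J1|J1 x n nx _ IH] J iJ La iJ1 H.
  by rewrite add0n; apply: length_ge_anti La; exact: sub_ideal_adj.
rewrite addSn; apply: (@LengthGeS _ _ (x * y)).
  move=> [s ns]; rewrite mulrA => /H [t nt Jts]; apply: nx.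
  by exists (t * s); [exact: primeMN|rewrite -mulrA].
apply: IH; [exact: ideal_adj_ideal| |exact: ideal_adj_ideal|].
  apply: length_ge_anti La; apply: ideal_adj_sub; first exact: ideal_adj_ideal.
    apply: ideal_adj_sub; [exact: ideal_adj_ideal|exact: sub_ideal_adj|].
    by apply: ideal_lmul; [exact: ideal_adj_ideal|exact: ideal_adj_mem].
  exact: ideal_adj_mem.
move=> r [c]; rewrite mulrA -mulrBl => /H [s ns Js].
by exists s => //; exists (s * c); rewrite -mulrA -mulrBr.
Qed.

Lemma length_geP P J n : length_ge P J n.+1 ->
  exists2 x, ~ sat P J x & length_ge P (ideal_adj J x) n.
Proof.
move En: n.+1 => k L; case: L En => // J1 x n' nx L [->]; by exists x.
Qed.

Lemma length_ge_sat1 P J n : sat P J 1 -> is_ideal J -> length_ge P J n -> n = 0%N.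
Proof.
case: n => // n [s ns Js] iJ /length_geP[x []]; exists s => //.
by rewrite -(mulr1 s); apply: ideal_rmul.
Qed.

Lemma length_ge_max P J n : is_prime P -> is_ideal J -> P `<=` sat P J ->
  length_ge P J n -> (n <= 1)%N.
Proof.
case: n => // n pP iJ PJ /length_geP[x nx] /length_ge_sat1 -> //.
  exists x; first by move/PJ.
  by rewrite mulr1; exact: ideal_adj_mem.
exact: ideal_adj_ideal.
Qed.

(** Noetherian induction: for [x] in [P] but not in [J A_P], with [x ^+ n.+1] the
    first power in [J A_P], both [J + (x ^+ n)] and [J : x ^+ n] are larger than [J]. *)
Lemma length_finite P J : is_prime P -> is_ideal J ->
  (forall x, P x -> exists n, sat P J (x ^+ n)) ->
  exists N, forall n, length_ge P J n -> (n <= N)%N.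
Proof.
move=> pP iJ nilJ; apply: contrapT => noJ.
pose F := [set J | [/\ is_ideal J, forall x, P x -> exists n, sat P J (x ^+ n) &
  ~ exists N, forall n, length_ge P J n -> (n <= N)%N]].
have [||M [iM nilM noM] [_ maxM]] := @noetherian_max A F J noeA.
- by move=> ? [].
- by split.
have bounded M' : is_ideal M' -> M `<=` M' -> M' <> M ->
    exists N, forall n, length_ge P M' n -> (n <= N)%N.
  move=> iM' MM' neq; apply: contrapT => no; apply: neq; apply: maxM => //.
  split=> // x Px; have [n Mx] := nilM _ Px; exists n; exact: sat_mono Mx.
have [PM|] := pselect (P `<=` sat P M).
  by apply: noM; exists 1%N => n; exact: length_ge_max.
move=> /existsNP[x /not_implyP[Px nMx]].
have exn : exists n, `[< sat P M (x ^+ n) >].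
  by have [n Mx] := nilM _ Px; exists n; apply/asboolP.
case: (ex_minnP exn) => -[|n] /asboolP Mxn minn.
  by apply: noM; exists 0%N => k /length_ge_sat1 -> //; move: Mxn; rewrite expr0.
have nMxn : ~ sat P M (x ^+ n).
  by move=> /asboolP /minn; rewrite ltnn.
have [s ns Msx] := Mxn.
have [|||Na aN] := bounded (ideal_adj M (x ^+ n)); first exact: ideal_adj_ideal.
- exact: sub_ideal_adj.
- by move=> E; apply: nMxn; apply: sub_sat => //; rewrite -E; exact: ideal_adj_mem.
have [|||Nb bN] := bounded (ideal_colon M (x ^+ n)); first exact: ideal_colon_ideal.
- exact: sub_ideal_colon.
- move=> E; apply: nMx; exists s => //; rewrite -E /ideal_colon /= -mulrA.
  by rewrite -exprS.
apply: noM; exists (Na + Nb)%N => k /(@length_ge_sub _ _ (x ^+ n)).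
move=> /(_ pP iM)[a [b [kab /aN aNa /bN bNb]]].
by apply: leq_trans kab _; exact: leq_add.
Qed.

(** Every strict step of the chain would raise the length of [A_P / E n A_P]. *)
Lemma length_finite_dcc P J (E : nat -> set A) N : is_prime P -> (forall n, is_ideal (E n)) ->
  (forall n, J `<=` E n) -> (forall n, E n.+1 `<=` E n) ->
  (forall n, length_ge P J n -> (n <= N)%N) ->
  exists n, E n `<=` sat P (E n.+1).
Proof.
move=> pP iE JE Edec bound; apply: contrapT => no.
have Ln n : length_ge P (E n) n.
  elim: n => [|n IHn]; first exact: LengthGe0.
  have [x /not_implyP[Ex nx]] : exists x, ~ (E n x -> sat P (E n.+1) x).
    by apply/existsNP => H; apply: no; exists n.
  apply: (LengthGeS nx); apply: length_ge_anti IHn.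
  by apply: ideal_adj_sub.
by have := bound _ (length_ge_anti (JE N.+1) (Ln _)); rewrite ltnn.
Qed.

(** * The height theorem *)

(** Krull's principal ideal theorem for [A / J].  As [A_P / (J + (x)) A_P] has finite
    length, the sums of [(x)] with the symbolic powers [S n] of [Q] become stationary;
    since [x] is not in [Q], Nakayama's lemma at [P] gives [S n = S n.+1], and at [Q]
    it then puts [Q ^ n] into [J A_Q]. *)
Lemma principal_ideal_theorem J x P Q : is_ideal J ->
  minimal_prime_of (ideal_adj J x) P -> is_prime Q -> J `<=` Q -> Q `<` P ->
  minimal_prime_of J Q.
Proof.
move=> iJ minP pQ JQ [QP nPQ]; have [pP JxP _] := minP.
have iJx := ideal_adj_ideal x iJ; have iQ := prime_ideal pQ; have iP := prime_ideal pP.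
have nQx : ~ Q x.
  move=> Qx; apply: nPQ; suff <- : Q = P by [].
  by case: minP => _ _; apply => //; exact: ideal_adj_sub.
pose QJ n := [set y | exists2 b, ideal_exp Q n b & J (y - b)].
have iQJ n : is_ideal (QJ n).
  have iQn := ideal_exp_ideal Q n.
  split=> [|y z [b Qb Jb] [c Qc Jc]|a y [b Qb Jb]].
  - by exists 0; rewrite ?subr0; exact: ideal0.
  - exists (b + c); first exact: idealD.
    by rewrite opprD addrACA; exact: idealD.
  - by exists (a * b); rewrite -?mulrBr; exact: ideal_lmul.
have JQJ n : J `<=` QJ n.
  by move=> y Jy; exists 0; rewrite ?subr0 //; exact: (ideal0 (ideal_exp_ideal Q n)).
pose S n := sat Q (QJ n).
have iS n : is_ideal (S n) by exact: sat_ideal.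
have QJdec n : QJ n.+1 `<=` QJ n.
  by move=> y [b Qb Jb]; exists b => //; apply: ideal_exp_le Qb.
pose E n := ideal_adj (S n) x.
have [N bound] : exists N, forall n, length_ge P (ideal_adj J x) n -> (n <= N)%N.
  apply: length_finite => // y Py.
  have [n [s ns Jy]] := minimal_prime_nilpotent iJx minP Py.
  by exists n, s.
have [||||n En] := @length_finite_dcc P (ideal_adj J x) E N pP.
- by move=> n; exact: ideal_adj_ideal.
- move=> n; apply: ideal_adjS; apply: (subset_trans _ (sub_sat pQ)).
  exact: JQJ.
- by move=> n; apply: ideal_adjS; apply: sat_mono; exact: QJdec.
- exact: bound.
have SS : S n `<=` S n.+1.
  suff: S n `<=` sat P (S n.+1).
    move=> sub y /sub [s ns]; apply: contraPP => nSy.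
    move=> Sy; apply: nSy; apply: (sat_idem pQ); exists s => //.
    by move=> /QP.
  apply: nakayama => // a Sa.
  have [s ns [r Sr]] : sat P (E n.+1) a by apply: En; exact: sub_ideal_adj.
  have Snr : S n r.
    apply: (sat_idem pQ); exists x => //; rewrite mulrC.
    have Sd : S n (s * a - r * x) by apply: sat_mono Sr.
    have -> : r * x = s * a - (s * a - r * x) by ring.
    exact: (idealB (iS n) (ideal_lmul s (iS n) Sa) Sd).
  exists s, (x * r); split=> //; last by rewrite (mulrC x).
  by apply: ideal_mulP => //; apply: JxP; exact: ideal_adj_mem.
have QnJ : ideal_exp Q n `<=` sat Q J.
  apply: nakayama => // [|a Qa]; first exact: ideal_exp_ideal.
  have [|s ns [b Qb Jb]] := SS a; last by exists s, b.
  by apply: sub_sat => //; exists a; rewrite ?subrr //; exact: ideal0.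
split=> // Q' pQ' JQ' Q'Q; apply/seteqP; split=> // z Qz.
by apply: (primeX (n := n)) => //; apply: (sat_sub pQ' JQ' Q'Q); apply: QnJ; exact: ideal_expX.
Qed.

(** Krull's height theorem.  Enlarge the last prime of the chain below [P] to a
    maximal one [Q], and let [y] be one of the [ys] outside [Q].  Modulo [y] the
    other [ys] have powers in [Q], locally at [P]; replacing them by the resulting
    elements [q z] of [Q], the principal ideal theorem shows that [Q] is minimal
    over these. *)
Lemma krull_height (ys : seq A) P c l :
  minimal_prime_of (ideal_gen [set` ys]) P -> prime_chain c l -> c l = P ->
  (l <= size ys)%N.
Proof.
have [n] := ubnP (size ys); elim: n ys P c l => // n IHn ys P c l.
rewrite ltnS => ysn minP [pc cS] clP; case: l => // l in pc cS clP *.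
have [pP ysP minP'] := minP; have iP := prime_ideal pP.
have iys := @ideal_gen_ideal A [set` ys].
have [Q [pQ clQ QP] maxQ] : exists2 Q, [/\ is_prime Q, c l `<=` Q & Q `<` P] &
    forall Q', is_prime Q' -> Q `<=` Q' -> Q' `<` P -> Q' = Q.
  pose F := [set Q | is_prime Q /\ Q `<` P].
  have [||Q [pQ QP] [clQ maxQ]] := @noetherian_max A F (c l) noeA.
  - by move=> ? [/prime_ideal].
  - split; first by apply: pc; exact: leqnSn.
    by rewrite -clP; exact: cS.
  by exists Q => // Q' pQ' QQ' Q'P; apply: maxQ.
have iQ := prime_ideal pQ; have [QsubP nPQ] := QP.
have [y yys nQy] : exists2 y, y \in ys & ~ Q y.
  apply: contrapT => no; apply: nPQ; suff -> : P = Q by [].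
  apply/esym/minP' => //; apply: ideal_gen_sub => // y yys.
  by apply: contrapT => nQy; apply: no; exists y.
have minQy : minimal_prime_of (ideal_adj Q y) P.
  split=> // [|Q' pQ' QyQ' Q'P].
    by apply: ideal_adj_sub => //; apply: ysP; exact: sub_ideal_gen.
  have QQ' : Q `<=` Q' by apply: subset_trans QyQ'; exact: sub_ideal_adj.
  apply: contrapT => neq; apply: nQy.
  rewrite -(maxQ _ pQ' QQ'); last first.
    by split=> // PQ'; apply: neq; apply/seteqP.
  by apply: QyQ'; exact: ideal_adj_mem.
pose ys' := rem y ys.
have ysE : [set` ys] = [set` y :: ys'].
  by apply/seteqP; split=> z /=; rewrite (perm_mem (perm_to_rem yys)).
have /choice[q qP] : forall z, exists q, P z ->
    Q q /\ exists k s r, ~ P s /\ s * z ^+ k = q + r * y.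
  move=> z; have [Pz|] := pselect (P z); last by exists 0.
  have [k [s ns [r Qr]]] := minimal_prime_nilpotent (ideal_adj_ideal y iQ) minQy Pz.
  exists (s * z ^+ k - r * y) => _; split=> //; exists k, s, r; split=> //.
  by rewrite subrK.
have ys'P z : z \in ys' -> P z.
  by move=> zys'; apply: ysP; apply: sub_ideal_gen; rewrite ysE /= inE zys' orbT.
have sz : (size [seq q z | z <- ys']).+1 = size ys.
  by rewrite size_map (perm_size (perm_to_rem yys)).
pose J := ideal_gen [set` [seq q z | z <- ys']].
have iJ : is_ideal J by exact: ideal_gen_ideal.
have JQ : J `<=` Q.
  by apply: ideal_gen_sub => // _ /= /mapP[z zys' ->]; case: (qP z (ys'P _ zys')).
have minJ : minimal_prime_of J Q.
  apply: (@principal_ideal_theorem J y P) => //; split=> // [|Q' pQ' JyQ' Q'P].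
    apply: ideal_adj_sub => //; first exact: subset_trans JQ QsubP.
    by apply: ysP; exact: sub_ideal_gen.
  have iQ' := prime_ideal pQ'.
  have Q'y : Q' y by apply: JyQ'; exact: ideal_adj_mem.
  apply: minP' => //; rewrite ysE; apply: ideal_gen_sub => // z /=.
  rewrite inE => /predU1P[->//|zys'].
  have [_ [k [s [r [ns szE]]]]] := qP z (ys'P _ zys').
  have : Q' (s * z ^+ k).
    rewrite szE; apply: idealD => //; last exact: ideal_lmul.
    by apply: JyQ'; apply: sub_ideal_adj; apply: sub_ideal_gen; exact: map_f.
  by move=> /(primeM pQ')[/Q'P//|/(primeX pQ')].
rewrite -sz ltnS.
pose c' i := if i == l then Q else c i.
apply: (IHn [seq q z | z <- ys'] Q c' l) => //.
- by rewrite -ltnS sz.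
- split=> i il; rewrite /c'; first by case: eqP => // _; apply: pc; exact: leqW.
  rewrite (ltn_eqF il); have [cs ncs] := cS i (leqW il).
  case: eqP => [E|_]; last exact: cS (leqW il).
  rewrite E in cs ncs; split; first exact: subset_trans cs clQ.
  by move=> Qc; apply: ncs; exact: subset_trans clQ Qc.
- by rewrite /c' eqxx.
Qed.

End NoetherianPrimes.

(** * Regular local rings *)

Section LocalRing.
Context {R : comNzRingType}.
Variable m : set R.
Hypotheses (noeR : noetherian R) (locR : local_ring m).
Implicit Types (J N : set R).

Lemma local_maximal_prime : is_prime m.
Proof. by apply: maximal_prime; case: locR. Qed.

Lemma local_proper_sub J : is_ideal J -> ~ J 1 -> J `<=` m.
Proof.
move=> iJ nJ1; pose F := [set M : set R | is_ideal M /\ ~ M 1].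
have [|M [iM nM1] [JM maxM]] := @noetherian_max R F J noeR _ (conj iJ nJ1).
  by move=> ? [].
case: locR => _ /(_ M) <- //; split=> // J' iJ' nJ'1 MJ'; exact: maxM.
Qed.

Lemma local_unit x : ~ m x -> exists u, u * x = 1.
Proof.
move=> nmx; apply: contrapT => no; apply: nmx.
apply: (@local_proper_sub (ideal_adj [set 0] x)).
- exact/ideal_adj_ideal/ideal_set0.
- by move=> [a /eqP]; rewrite subr_eq0 => /eqP ax; apply: no; exists a.
- exact/ideal_adj_mem/ideal_set0.
Qed.

Lemma sat_local J : is_ideal J -> sat m J `<=` J.
Proof.
move=> iJ x [s /local_unit[u us1] Jsx].
by rewrite -(mul1r x) -us1 -mulrA; exact: ideal_lmul.
Qed.

Lemma nakayama_local J N : is_ideal J -> is_ideal N ->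
  (forall a, N a -> exists2 b, ideal_mul m N b & J (a - b)) -> N `<=` J.
Proof.
move=> iJ iN H; apply: (subset_trans _ (sat_local iJ)).
apply: nakayama => // [|a /H[b mNb Jab]]; first exact: local_maximal_prime.
by exists 1, b; rewrite mul1r; split=> //; exact/primeN1/local_maximal_prime.
Qed.

(** A generating sequence of [m] of the smallest length that the height theorem
    allows. *)
Definition parameters (s : seq R) :=
  m = ideal_gen [set` s] /\ exists2 c, prime_chain c (size s) & c (size s) = m.

Lemma parameters_min (s t : seq R) :
  parameters s -> m = ideal_gen [set` t] -> (size s <= size t)%N.
Proof.
move=> [_ [c cs cm]] mt; apply: (krull_height noeR (P := m) _ cs cm).
split; [exact: local_maximal_prime|by rewrite -mt|].
by move=> Q _; rewrite -mt => mQ Qm; apply/seteqP.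
Qed.

(** Replace the first of the remaining parameters by an element [y] congruent to it
    modulo the others and outside the minimal primes of [gen s1]; the height theorem
    makes this possible.  Then [gen s1 + (y)] is prime by induction, and a minimal
    prime [Q] of [gen s1] below it satisfies [Q = gen s1 + y Q]. *)
Lemma parameters_prime (s1 s2 : seq R) :
  parameters (s1 ++ s2) -> is_prime (ideal_gen [set` s1]).
Proof.
elim: s2 s1 => [|x s2 IHs] s1.
  by rewrite cats0 => -[<- _]; exact: local_maximal_prime.
move=> par; have [mE [c cs cm]] := par.
have iJ := @ideal_gen_ideal R [set` s1]; set J := ideal_gen [set` s1] in iJ *.
have pm := local_maximal_prime.
have Jm : J `<=` m.
  rewrite mE; apply: ideal_gen_sub => [|y ys]; first exact: ideal_gen_ideal.
  by apply: sub_ideal_gen; rewrite /= mem_cat ys.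
have nmin : ~ minimal_prime_of J m.
  move=> minm; have := krull_height noeR minm cs cm.
  by rewrite size_cat /= => ?; lia.
have [l lmin lcov] := noetherian_minimal_primes noeR iJ.
have iK := @ideal_gen_ideal R [set` s2].
have [||z Kz avz] := @prime_avoidance R _ x l iK.
- by move=> Q /lmin[].
- move=> Q Ql [Qx KQ]; have [pQ JQ minQ] := lmin _ Ql; apply: nmin.
  have mQ : m `<=` Q.
    rewrite mE; apply: ideal_gen_sub => [|y /=]; first exact: prime_ideal.
    rewrite mem_cat inE => /or3P[ys|/eqP->//|ys].
      by apply: JQ; exact: sub_ideal_gen.
    by apply: KQ; exact: sub_ideal_gen.
  suff -> : m = Q by [].
  apply/seteqP; split=> //; apply: local_proper_sub; first exact: prime_ideal.
  exact: primeN1.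
set y := x + z in avz.
have pT : is_prime (ideal_gen [set` rcons s1 y]).
  apply: (IHs); rewrite /parameters cat_rcons; split; last first.
    by exists c; [move: cs|move: cm]; rewrite !size_cat.
  rewrite mE; apply/seteqP; split; apply: ideal_gen_sub;
      try exact: ideal_gen_ideal; move=> w /=; rewrite mem_cat inE;
      have iG := @ideal_gen_ideal R [set` s1 ++ y :: s2];
      have iG' := @ideal_gen_ideal R [set` s1 ++ x :: s2].
    case/or3P => [ws|/eqP->|ws]; [by apply: sub_ideal_gen; rewrite /= mem_cat ws| |
      by apply: sub_ideal_gen; rewrite /= mem_cat inE ws !orbT].
    rewrite -(addrK z x); apply: (idealB iG).
      by apply: sub_ideal_gen; rewrite /= mem_cat inE eqxx orbT.
    apply: ideal_gen_sub Kz => // v vs; apply: sub_ideal_gen.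
    by rewrite /= mem_cat inE [v \in s2]vs !orbT.
  case/or3P => [ws|/eqP->|ws]; [by apply: sub_ideal_gen; rewrite /= mem_cat ws| |
    by apply: sub_ideal_gen; rewrite /= mem_cat inE ws !orbT].
  apply: (idealD iG').
    by apply: sub_ideal_gen; rewrite /= mem_cat inE eqxx orbT.
  apply: ideal_gen_sub Kz => // v vs; apply: sub_ideal_gen.
  by rewrite /= mem_cat inE [v \in s2]vs !orbT.
have TE : ideal_gen [set` rcons s1 y] = ideal_adj J y.
  rewrite -ideal_gen_cons; congr ideal_gen; apply/seteqP.
  by split=> w /=; rewrite mem_rcons.
have [|Q Ql QT] := lcov _ pT; first by rewrite TE; exact: sub_ideal_adj.
have [pQ JQ _] := lmin _ Ql; have iQ := prime_ideal pQ.
suff QJ : Q `<=` J by suff -> : J = Q by []; apply/seteqP.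
apply: nakayama_local => // q Qq.
have [a Ja] : ideal_adj J y q by rewrite -TE; exact: QT.
have Qay : Q (a * y).
  have -> : a * y = q - (q - a * y) by ring.
  by apply: idealB => //; exact: JQ.
exists (y * a); last by rewrite mulrC.
apply: ideal_mulP; last by case: (primeM pQ Qay) => // /(avz _ Ql).
apply: (@local_proper_sub (ideal_adj J y)).
- exact: ideal_adj_ideal.
- by rewrite -TE; exact: primeN1.
- exact: ideal_adj_mem.
Qed.

End LocalRing.

(** * Regular sequences on modules *)

Definition upd_exp d (a : 'I_d -> nat) l k := fun i => if i == l then k else a i.

Lemma upd_expE d (a : 'I_d -> nat) l k : upd_exp a l k l = k.
Proof. by rewrite /upd_exp eqxx. Qed.

Lemma upd_exp_gt0 d (a : 'I_d -> nat) l k : (forall i, 0 < a i)%N -> (0 < k)%N ->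
  forall i, (0 < upd_exp a l k i)%N.
Proof. by move=> a_gt0 k_gt0 i; rewrite /upd_exp; case: eqP. Qed.

Section PowerSubmodules.
Context {R : comNzRingType} {M : lmodType R} {d : nat}.
Variable x : 'I_d -> R.
Implicit Types (a b : 'I_d -> nat) (T : {set 'I_d}).

(** Both the exponents [a] and the set [T] of indices vary, because regularity is
    proved by induction on them. *)
Definition pow_sub a T : set M :=
  [set v | exists w : 'I_d -> M, v = \sum_(i in T) x i ^+ a i *: w i].

Definition nzd_mod (y : R) (N : set M) := forall v, N (y *: v) -> N v.

(** The [x i ^+ a i], in every order, form a regular sequence on [M]; an element
    and its powers are zero divisors together, so it suffices to test the [x i]. *)
Definition pow_regular a :=
  forall T i, i \notin T -> nzd_mod (x i) (pow_sub a T).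

Lemma pow_sub0 a T : pow_sub a T 0.
Proof. by exists (fun=> 0); rewrite big1 // => i _; rewrite scaler0. Qed.

Lemma pow_subD a T u v : pow_sub a T u -> pow_sub a T v -> pow_sub a T (u + v).
Proof.
move=> [w ->] [w' ->]; exists (fun i => w i + w' i); rewrite -big_split /=.
by apply: eq_bigr => i _; rewrite scalerDr.
Qed.

Lemma pow_subZ a T r v : pow_sub a T v -> pow_sub a T (r *: v).
Proof.
move=> [w ->]; exists (fun i => r *: w i); rewrite scaler_sumr.
by apply: eq_bigr => i _; rewrite !scalerA mulrC.
Qed.

Lemma pow_subB a T u v : pow_sub a T u -> pow_sub a T v -> pow_sub a T (u - v).
Proof.
by move=> Tu Tv; apply: pow_subD => //; rewrite -scaleN1r; exact: pow_subZ.
Qed.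

Lemma pow_sub_sum a T (I : Type) (r : seq I) (C : pred I) (F : I -> M) :
  (forall i, C i -> pow_sub a T (F i)) -> pow_sub a T (\sum_(i <- r | C i) F i).
Proof.
by move=> TF; elim/big_ind: _ => //; [exact: pow_sub0|move=> *; exact: pow_subD].
Qed.

Lemma eq_pow_sub a b T : {in T, a =1 b} -> pow_sub a T = pow_sub b T.
Proof.
move=> ab; apply/seteqP; split=> v [w ->]; exists w; apply: eq_bigr => i iT.
  by rewrite ab.
by rewrite ab.
Qed.

Lemma pow_sub_set0 a : pow_sub a finset.set0 = [set 0].
Proof.
by apply/seteqP; split=> v; [case=> w ->|move=> ->; exact: pow_sub0]; rewrite big_set0.
Qed.

Lemma pow_subD1 a T l v : l \in T ->
  pow_sub a T v <-> exists2 u, pow_sub a (T :\ l) u & exists w, v = x l ^+ a l *: w + u.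
Proof.
move=> lT; split=> [[w ->]|[u [w ->] [z ->]]].
  exists (\sum_(i in T :\ l) x i ^+ a i *: w i); first by exists w.
  by exists (w l); rewrite (big_setD1 l).
exists (fun i => if i == l then z else w i); rewrite [RHS](big_setD1 l) //= eqxx.
by congr (_ + _); apply: eq_bigr => i; rewrite !inE => /andP[/negbTE ->].
Qed.

Lemma nzd_modX y (N : set M) k v : nzd_mod y N -> N (y ^+ k *: v) -> N v.
Proof.
move=> nzd; elim: k => [|k IHk]; first by rewrite scale1r.
by rewrite exprS -scalerA => /nzd.
Qed.

Lemma pow_sub_upd a T l k : l \notin T -> pow_sub (upd_exp a l k) T = pow_sub a T.
Proof.
move=> lT; apply: eq_pow_sub => i iT; rewrite /upd_exp; case: eqP => // il.
by rewrite -il iT in lT.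
Qed.

(** Exponents are raised one at a time, along the exact sequence
    [0 -> M/(x_l, ...) -> M/(x_l^k, ...) -> M/(x_l^(k-1), ...)], in which the dots
    stand for the other powers. *)
Lemma pow_regular_pow a : (forall i, (0 < a i)%N) ->
  pow_regular (fun=> 1%N) -> pow_regular a.
Proof.
move=> a_gt0 reg1 T i; have [n] := ubnP (\sum_(j in T) a j)%N.
elim: n => // n IHn in a a_gt0 T i *; rewrite ltnS => an iT.
have [/existsP[l /andP[lT al]]|no] := boolP [exists l, (l \in T) && (1 < a l)%N]; last first.
  rewrite (@eq_pow_sub a (fun=> 1%N)); first exact: reg1.
  move=> j jT; apply/eqP; rewrite eqn_leq a_gt0 andbT leqNgt; apply/negP => aj.
  by case/existsP: no; exists j; rewrite jT.
have lTl : l \notin T :\ l by rewrite !inE eqxx.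
have il : i != l by apply: contraNneq iT => ->.
have small k : (0 < k < a l)%N -> nzd_mod (x i) (pow_sub (upd_exp a l k) T).
  move=> /andP[k0 kal]; apply: IHn => // [j|].
    by rewrite /upd_exp; case: eqP.
  apply: leq_trans an; rewrite (big_setD1 l) //= [ltnRHS](big_setD1 l) //= upd_expE.
  rewrite (eq_bigr a); first by rewrite ltn_add2r.
  by move=> j; rewrite !inE /upd_exp => /andP[/negbTE ->].
have nzdl : nzd_mod (x l) (pow_sub a (T :\ l)).
  apply: IHn => //; apply: leq_trans an; rewrite [ltnRHS](big_setD1 l) //=.
  by rewrite -[ltnLHS]add0n ltn_add2r.
have aS : a l = (a l).-1.+1 by rewrite prednK.
move=> v Txv; have [w0 Tw0 [w xvE]] := (pow_subD1 _ _ lT).1 Txv.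
have /small/(_ v) : (0 < (a l).-1 < a l)%N by lia.
have/[swap]/[apply] : pow_sub (upd_exp a l (a l).-1) T (x i *: v).
  apply/(pow_subD1 _ _ lT); exists w0; first by rewrite pow_sub_upd.
  by exists (x l *: w); rewrite scalerA upd_expE -exprSr -aS.
move/(pow_subD1 _ _ lT); rewrite pow_sub_upd // upd_expE => -[u0 Tu0 [u vE]].
have : pow_sub a (T :\ l) (x i *: u - x l *: w).
  apply: (nzd_modX (k := (a l).-1) nzdl).
  have -> : x l ^+ (a l).-1 *: (x i *: u - x l *: w) = w0 - x i *: u0.
    rewrite scalerBr !scalerA -exprSr -aS.
    have -> : x l ^+ (a l).-1 * x i = x i * x l ^+ (a l).-1 by rewrite mulrC.
    have := xvE; rewrite vE scalerDr scalerA => /(canRL (addrK _)) ->.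
    by rewrite addrAC (addrC _ w0) addrK.
  by apply: pow_subB => //; exact: pow_subZ.
move=> Txu; have /small/(_ u) : (0 < 1 < a l)%N by [].
have/[swap]/[apply] : pow_sub (upd_exp a l 1) T (x i *: u).
  apply/(pow_subD1 _ _ lT); exists (x i *: u - x l *: w).
    by rewrite pow_sub_upd.
  by exists w; rewrite upd_expE expr1 addrC subrK.
move/(pow_subD1 _ _ lT); rewrite pow_sub_upd // upd_expE => -[z0 Tz0 [z uE]].
apply/(pow_subD1 _ _ lT); exists (x l ^+ (a l).-1 *: z0 + u0).
  by apply: pow_subD => //; exact: pow_subZ.
by exists z; rewrite vE uE scalerDr scalerA expr1 -exprSr -aS addrA.
Qed.

(** Exponents are lowered one at a time: multiplication by [x l] embeds
    [M/(x_l^(k-1), ...)] into [M/(x_l^k, ...)]. *)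
Lemma pow_regular_root a : (forall i, (0 < a i)%N) ->
  pow_regular a -> pow_regular (fun=> 1%N).
Proof.
have [n] := ubnP (\sum_i a i)%N; elim: n => // n IHn in a *.
rewrite ltnS => an a_gt0 rega.
have [/existsP[l al]|no] := boolP [exists l, (1 < a l)%N]; last first.
  move=> T i iT; rewrite -(@eq_pow_sub a (fun=> 1%N)); first exact: rega.
  move=> j jT; apply/eqP; rewrite eqn_leq a_gt0 andbT leqNgt; apply/negP => aj.
  by case/existsP: no; exists j.
have aS : a l = (a l).-1.+1 by rewrite prednK.
apply: (IHn (upd_exp a l (a l).-1)).
- apply: leq_trans an; rewrite (bigD1 l) //= [ltnRHS](bigD1 l) //= upd_expE.
  rewrite (eq_bigr a); first by rewrite ltn_add2r; lia.
  by move=> j; rewrite /upd_exp => /negbTE ->.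
- by move=> j; rewrite /upd_exp; case: eqP => // _; lia.
move=> T i iT v; have [lT|lT] := boolP (l \in T); last first.
  by rewrite pow_sub_upd //; exact: rega.
have lTl : l \notin T :\ l by rewrite !inE eqxx.
move/(pow_subD1 _ _ lT); rewrite pow_sub_upd // upd_expE => -[w0 Tw0 [w xvE]].
have /(rega _ _ iT) : pow_sub a T (x i *: (x l *: v)).
  apply/(pow_subD1 _ _ lT); exists (x l *: w0); first exact: pow_subZ.
  exists w; rewrite scalerA mulrC -scalerA xvE scalerDr scalerA -exprS -aS //.
move/(pow_subD1 _ _ lT) => [u0 Tu0 [u xvE']].
apply/(pow_subD1 _ _ lT); rewrite pow_sub_upd // upd_expE.
exists (v - x l ^+ (a l).-1 *: u); last by exists u; rewrite addrC subrK.
apply: (rega _ _ lTl); rewrite scalerBr scalerA -exprS -aS xvE' addrAC subrr add0r.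
by [].
Qed.

End PowerSubmodules.

Arguments pow_sub {R} M {d} x a T.
Arguments pow_regular {R} M {d} x a.

Lemma regular_parameters (R : comNzRingType) (m : set R) : regular_local_ring m ->
  exists (d : nat) (x : 'I_d -> R), parameters m [seq x i | i <- enum 'I_d].
Proof.
move=> [noeR locR [s [[[c [cp cS]] _] mE]]].
exists (size s), (fun i => s`_i).
have -> : map (fun i : 'I_(size s) => s`_i) (enum 'I_(size s)) = s.
  by rewrite -[RHS](mkseq_nth 0) /mkseq -val_enum_ord -map_comp.
split=> //; exists (fun i => if i == size s then m else c i); last by rewrite eqxx.
split=> i il; first by case: eqP => // _; [exact: local_maximal_prime locR|exact: cp].
rewrite (ltn_eqF il); case: eqP => [E|_]; last exact: cS.
have [ci nci] := cS _ il; have pcS : is_prime (c i.+1) by exact: cp.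
have cm : c i.+1 `<=` m.
  by apply: local_proper_sub => //; [exact: prime_ideal|exact: primeN1].
by split=> [|mc]; [exact: subset_trans ci cm|apply: nci; exact: subset_trans cm mc].
Qed.

Definition fin_gen (R : comNzRingType) (M : lmodType R) :=
  exists n (g : 'I_n -> M), forall v, exists c : 'I_n -> R, v = \sum_i c i *: g i.

Lemma fin_gen_finType (R : comNzRingType) (M : lmodType R) (I : finType) (g : I -> M) :
  (forall v, exists c : I -> R, v = \sum_i c i *: g i) -> fin_gen M.
Proof.
move=> gP; exists #|I|, (fun k => g (enum_val k)) => v; have [c ->] := gP v.
by exists (fun k => c (enum_val k)); rewrite (reindex _ (onW_bij _ (enum_val_bij I))).
Qed.

Section RegularLocal.
Context {R : comNzRingType}.
Variables (m : set R) (d : nat) (x : 'I_d -> R).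
Hypotheses (noeR : noetherian R) (locR : local_ring m).
Hypothesis parx : parameters m [seq x i | i <- enum 'I_d].
Implicit Types (T : {set 'I_d}).

Local Notation one := (fun=> 1%N).

Lemma pow_sub_gen T :
  pow_sub R^o x one T = ideal_gen [set` [seq x i | i <- enum T]].
Proof.
have iG := @ideal_gen_ideal R [set` [seq x i | i <- enum T]].
apply/seteqP; split=> [_ [w ->]|].
  apply: ideal_sum => // i iT.
  have -> : x i ^+ 1 *: w i = w i * x i by rewrite expr1; exact: mulrC.
  apply: (ideal_lmul _ iG); apply: sub_ideal_gen => /=.
  by rewrite map_f // mem_enum.
apply: ideal_gen_sub.
  split=> [|u v|a u]; [exact: pow_sub0|exact: pow_subD|exact: pow_subZ].
move=> _ /= /mapP[i + ->]; rewrite mem_enum => iT.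
exists (fun j => (j == i)%:R); rewrite (bigD1 i) //= eqxx expr1.
rewrite big1 => [|j /andP[_ /negbTE ->]]; last by rewrite scaler0.
by rewrite addr0 [RHS]mulr1.
Qed.

Lemma pow_sub_ideal T : is_ideal (pow_sub R^o x one T).
Proof. by rewrite pow_sub_gen; exact: ideal_gen_ideal. Qed.

Lemma pow_sub_setT : pow_sub R^o x one [set: 'I_d]%SET = m.
Proof.
rewrite pow_sub_gen; case: parx => -> _.
by rewrite (eq_enum (B := 'I_d)) // => i; rewrite !inE.
Qed.

Lemma pow_sub_prime T : is_prime (pow_sub R^o x one T).
Proof.
rewrite pow_sub_gen.
apply: (@parameters_prime _ m noeR locR _ [seq x i | i <- enum (~: T)]).
have perm : perm_eq ([seq x i | i <- enum T] ++ [seq x i | i <- enum (~: T)])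
    [seq x i | i <- enum 'I_d].
  rewrite -map_cat perm_map // uniq_perm ?enum_uniq // ?cat_uniq ?enum_uniq /=.
    by rewrite andbT; apply/hasPn => i; rewrite !mem_enum !inE.
  by move=> i; rewrite mem_cat !mem_enum !inE; case: (i \in T).
case: parx => mE [c cs cm]; split.
  by rewrite mE; congr ideal_gen; apply/seteqP; split=> y /=; rewrite (perm_mem perm).
by exists c; rewrite (perm_size perm).
Qed.

Lemma parameters_notin T i : i \notin T -> ~ pow_sub R^o x one T (x i).
Proof.
move=> iT; rewrite pow_sub_gen => Txi.
have iG := @ideal_gen_ideal R [set` [seq x j | j <- enum (~: [set i])%SET]].
have : m = ideal_gen [set` [seq x j | j <- enum (~: [set i])%SET]].
  case: parx => -> _; apply/seteqP; split; apply: ideal_gen_sub => //.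
  - move=> _ /= /mapP[j _ ->]; have [->|ji] := eqVneq j i.
      apply: ideal_gen_sub Txi => // _ /= /mapP[k + ->]; rewrite mem_enum => kT.
      apply: sub_ideal_gen; rewrite /= map_f // mem_enum !inE.
      by apply: contraNneq iT => <-.
    by apply: sub_ideal_gen; rewrite /= map_f // mem_enum !inE.
  - exact: ideal_gen_ideal.
  - move=> _ /= /mapP[j _ ->]; apply: sub_ideal_gen.
    by rewrite /= map_f // mem_enum.
move/(parameters_min noeR locR parx);
rewrite (size_map x (enum 'I_d)) size_enum_ord (size_map x) -cardE.
by rewrite cardsC1 card_ord; have := ltn_ord i; lia.
Qed.

Lemma parameters_regular : pow_regular R^o x one.
Proof.
move=> T i iT v Txv; have [/(parameters_notin iT)|//] := primeM (pow_sub_prime T) Txv.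
by [].
Qed.

Lemma regular_local_domain (a b : R) : a * b = 0 -> a = 0 \/ b = 0.
Proof.
have := pow_sub_prime finset.set0; rewrite pow_sub_set0 => p0 ab0.
exact: (primeM p0).
Qed.

(** Coordinates of relations between minimal generators lie in [m]; by descending
    induction on [T] they lie in the ideal generated by the [x i] with [i] in [T], and
    for empty [T] they vanish. *)
Lemma regular_module_free (M : lmodType R) : fin_gen M -> pow_regular M x one ->
  exists n (b : 'I_n -> M), (forall v, exists c : 'I_n -> R, v = \sum_i c i *: b i) /\
    forall c : 'I_n -> R, \sum_i c i *: b i = 0 -> forall i, c i = 0.
Proof.
move=> fgM regM.
have exn : exists n, `[< exists g : 'I_n -> M,
    forall v, exists c : 'I_n -> R, v = \sum_i c i *: g i >].
  by have [n fg] := fgM; exists n; apply/asboolP.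
case: (ex_minnP exn) => n /asboolP[b bP] minn; exists n, b; split=> //.
have pm := local_maximal_prime locR; have im := prime_ideal pm.
suff C T : forall c : 'I_n -> R, pow_sub M x one T (\sum_i c i *: b i) ->
    forall i, pow_sub R^o x one T (c i).
  move=> c c0 i; have := C finset.set0 c; rewrite c0 !pow_sub_set0.
  by move=> /(_ erefl i).
have [k] := ubnP #|~: T|; elim: k T => // k IHk T; rewrite ltnS => Tk.
have [TT|/existsNP[l lT]] := pselect (forall l, l \in T).
  have {Tk TT}-> : T = [set: 'I_d]%SET by apply/setP => l; rewrite TT inE.
  move=> c [w wE] i; rewrite pow_sub_setT; apply: contrapT => nci.
  have /choice[f fP] : forall j, exists f : 'I_n -> R, w j = \sum_k f k *: b k.
    by move=> j; exact: bP.
  pose g k := \sum_j x j * f j k.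
  have mg k' : m (g k').
    apply: ideal_sum => // j _; rewrite mulrC; apply: (ideal_lmul _ im).
    rewrite -pow_sub_setT pow_sub_gen; apply: sub_ideal_gen.
    by rewrite /= map_f // mem_enum inE.
  have cg0 : \sum_k (c k - g k) *: b k = 0.
    under eq_bigr do rewrite scalerBl.
    rewrite sumrB wE; apply/eqP; rewrite subr_eq0; apply/eqP.
    under [RHS]eq_bigr do rewrite scaler_suml.
    rewrite exchange_big /= big_mkcond; apply: eq_bigr => j _.
    rewrite inE expr1 fP scaler_sumr; apply: eq_bigr => k' _.
    by rewrite scalerA.
  (* The [i]-th generator is then redundant. *)
  have [u ui] : exists u, u * (c i - g i) = 1.
    apply: (local_unit noeR locR) => mcg; apply: nci.
    by rewrite -(subrK (g i) (c i)); exact: idealD.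
  case: n => [|n] in b bP minn {IHk} c wE i nci f fP g mg cg0 u ui exn *; first by case: i {nci ui}.
  have : (n < n)%N; last by rewrite ltnn.
  apply: minn; apply/asboolP; exists (fun k => b (lift i k)) => v.
  have [h ->] := bP v.
  have biE : b i = \sum_k (- u * (c (lift i k) - g (lift i k))) *: b (lift i k).
    move: cg0; rewrite (bigD1_ord i) //= => /(congr1 (fun z => u *: z)).
    rewrite scalerDr scaler0 scalerA ui scale1r => /eqP; rewrite addr_eq0 => /eqP ->.
    rewrite scaler_sumr -sumrN; apply: eq_bigr => k' _.
    by rewrite scalerA mulNr scaleNr.
  exists (fun k => h (lift i k) + h i * (- u * (c (lift i k) - g (lift i k)))).
  rewrite (bigD1_ord i) //= {1}biE scaler_sumr -big_split /=.
  by apply: eq_bigr => k' _; rewrite scalerDl scalerA addrC.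
have {}lT : l \notin T by apply/negP.
have Cl : forall c : 'I_n -> R, pow_sub M x one (l |: T) (\sum_i c i *: b i) ->
    forall i, pow_sub R^o x one (l |: T) (c i).
  apply: IHk; apply: leq_trans Tk; apply: proper_card; apply/properP; split.
    by rewrite finset.setCS finset.subsetUr.
  by exists l; rewrite !inE ?eqxx // lT.
move=> c Tc i.
(* [D <= (x_T) + x_l D], because [x l] is regular modulo [(x_T) M]. *)
pose D := [set r : R | exists c : 'I_n -> R,
  pow_sub M x one T (\sum_i c i *: b i) /\ r = c i].
suff: D `<=` pow_sub R^o x one T by apply; exists c.
apply: (nakayama_local noeR locR); first exact: pow_sub_ideal.
  split=> [|_ _ [c1 [T1 ->]] [c2 [T2 ->]]|a _ [c1 [T1 ->]]].
  - exists (fun=> 0); split=> //; rewrite big1; first exact: pow_sub0.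
    by move=> j _; rewrite scale0r.
  - exists (fun i => c1 i + c2 i); split=> //.
    under eq_bigr do rewrite scalerDl.
    by rewrite big_split /=; exact: pow_subD.
  - exists (fun i => a * c1 i); split=> //.
    under eq_bigr do rewrite -scalerA.
    by rewrite -scaler_sumr; exact: pow_subZ.
move=> _ [{Tc}c [Tc ->]].
have lTl : (l |: T) :\ l = T by rewrite setU1K.
have /choice[s sP] : forall j, exists s, pow_sub R^o x one T (c j - x l * s).
  move=> j; have [|u Tu [s ->]] := (pow_subD1 (M := R^o) x one (c j) (setU11 l T)).1 (Cl c _ j).
    by apply/(pow_subD1 _ _ _ (setU11 l T)); rewrite lTl; exists (\sum_i c i *: b i) => //;
      exists 0; rewrite scaler0 add0r.
  by exists s; rewrite expr1 lTl in Tu *; rewrite addrC addKr.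
exists (x l * s i) => //; apply: ideal_mulP.
  rewrite -pow_sub_setT pow_sub_gen; apply: sub_ideal_gen.
  by rewrite /= map_f // mem_enum inE.
exists s; split=> //; apply: (regM _ _ lT).
have -> : x l *: (\sum_k s k *: b k) =
    \sum_k c k *: b k - \sum_k (c k - x l * s k) *: b k.
  rewrite scaler_sumr -sumrB; apply: eq_bigr => j _.
  by rewrite scalerA -scalerBl opprB addrCA subrr addr0.
apply: pow_subB => //; apply: pow_sub_sum => j _; have [w ->] := sP j.
rewrite scaler_suml; apply: pow_sub_sum => k' k'T.
exists (fun k => if k == k' then w k' *: b j else 0).
rewrite (bigD1 k') //= eqxx big1 ?addr0 => [|k'' /andP[_ /negbTE ->]].
  by rewrite -scalerA.
by rewrite scaler0.
Qed.

End RegularLocal.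

(** * Frobenius-linear maps *)

Section FrobeniusLinear.
Context {A : comNzRingType} {p : nat}.
Variable charA : p \in [pchar A].

(** The [A]-linear maps from [A^{1/q}] to [A], read on [A]. *)
Definition frob_linear (e : nat) (f : A -> A) :=
  (forall y z, f (y + z) = f y + f z) /\
  forall a y, f (a ^+ (p ^ e) * y) = a * f y.

Lemma root_splitsP e d :
  root_splits charA e d <-> exists2 f, frob_linear e f & f d = 1.
Proof.
split=> [[g gP]|[f [fD fZ] fd]].
  exists (fun y : A => g (rth_root charA e y)); last first.
    by have := gP 1; rewrite scale1r.
  split=> [y z|a y]; first exact: (raddfD g).
  by rewrite -[RHS]/(a *: g (rth_root charA e y)) -linearZ.
have lin : linear (f : root_ring charA e -> A^o).
  by move=> a u v; rewrite fD; congr (_ + _); exact: fZ.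
pose g : {linear root_ring charA e -> A^o} :=
  HB.pack (f : root_ring charA e -> A^o) (GRing.isLinear.Build A
    (root_ring charA e) A^o *:%R f lin).
exists g => a; rewrite linearZ -[RHS]mulr1 -fd.
by [].
Qed.

Lemma frobD e a b : (a + b : A) ^+ (p ^ e) = a ^+ (p ^ e) + b ^+ (p ^ e).
Proof. exact: (rmorphD (root_incl charA e)). Qed.

Lemma frobN e a : (- a : A) ^+ (p ^ e) = - a ^+ (p ^ e).
Proof. exact: (rmorphN (root_incl charA e)). Qed.

Lemma frob_sum e (T : Type) (r : seq T) (C : pred T) (F : T -> A) :
  (\sum_(i <- r | C i) F i) ^+ (p ^ e) = \sum_(i <- r | C i) F i ^+ (p ^ e).
Proof. exact: (rmorph_sum (root_incl charA e)). Qed.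

Lemma pchar_expn_gt0 e : (0 < p ^ e)%N.
Proof. by rewrite expn_gt0 prime_gt0 // (pcharf_prime charA). Qed.

Lemma frob0 e : (0 : A) ^+ (p ^ e) = 0.
Proof. by rewrite expr0n; case: (p ^ e)%N (pchar_expn_gt0 e). Qed.

Lemma frob_linear0 e f : frob_linear e f -> f 0 = 0.
Proof. by move=> [fD _]; apply: (addrI (f 0)); rewrite -fD !addr0. Qed.

Lemma frob_linear_sum e f (T : Type) (r : seq T) (C : pred T) (F : T -> A) :
  frob_linear e f -> f (\sum_(i <- r | C i) F i) = \sum_(i <- r | C i) f (F i).
Proof.
by move=> lf; apply: (big_morph f); [case: lf|exact: frob_linear0 lf].
Qed.

Lemma frob_linearB e f y z : frob_linear e f -> f (y - z) = f y - f z.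
Proof.
by move=> lf; apply/eqP; rewrite eq_sym subr_eq; case: lf => [<- _]; rewrite subrK.
Qed.

Lemma frob_linear_comp e1 e2 f g : frob_linear e1 f -> frob_linear e2 g ->
  frob_linear (e1 + e2) (fun y => g (f y)).
Proof.
move=> [fD fZ] [gD gZ]; split=> [y z|a y]; first by rewrite fD gD.
by rewrite expnD mulnC exprM fZ gZ.
Qed.

Lemma frob_linear_mul e f c : frob_linear e f -> frob_linear e (fun y => f (c * y)).
Proof.
by move=> [fD fZ]; split=> [y z|a y]; rewrite ?mulrDr // mulrCA fZ.
Qed.

Lemma frob_linear_scale e f c : frob_linear e f -> frob_linear e (fun y => c * f y).
Proof.
by move=> [fD fZ]; split=> [y z|a y]; rewrite ?fD ?mulrDr // fZ mulrCA.
Qed.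

(** A basis of [A^{1/q}] over [A], with the coordinate functions. *)
Record frob_basis (e : nat) := FrobBasis {
  fb_rank : nat;
  fb_elt : 'I_fb_rank -> A;
  fb_coord : A -> 'I_fb_rank -> A;
  fb_coordE : forall y, y = \sum_i fb_coord y i ^+ (p ^ e) * fb_elt i;
  fb_free : forall c : 'I_fb_rank -> A,
    \sum_i c i ^+ (p ^ e) * fb_elt i = 0 -> forall i, c i = 0 }.

Arguments fb_coord {e} f.
Arguments fb_elt {e f}.

Lemma fb_coord_unique e (B : frob_basis e) y (c : 'I_(fb_rank B) -> A) :
  y = \sum_i c i ^+ (p ^ e) * fb_elt i -> forall i, fb_coord B y i = c i.
Proof.
move=> yE i; apply/eqP; rewrite -subr_eq0; apply/eqP.
apply: (@fb_free _ B (fun i => fb_coord B y i - c i)).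
under eq_bigr do rewrite frobD frobN mulrBl.
by rewrite sumrB -fb_coordE -yE subrr.
Qed.

Lemma fb_coord_linear e (B : frob_basis e) i : frob_linear e (fun y => fb_coord B y i).
Proof.
split=> [y z|a y].
  apply: (fb_coord_unique (c := fun i => fb_coord B y i + fb_coord B z i)).
  rewrite {1}(fb_coordE B y) {1}(fb_coordE B z) -big_split.
  by apply: eq_bigr => j _; rewrite frobD mulrDl.
apply: (fb_coord_unique (c := fun i => a * fb_coord B y i)).
rewrite {1}(fb_coordE B y) mulr_sumr; apply: eq_bigr => j _.
by rewrite mulrA -exprMn.
Qed.

Definition fb_map e (B : frob_basis e) (v : 'I_(fb_rank B) -> A) (y : A) :=
  \sum_i fb_coord B y i * v i.

Lemma fb_map_linear e (B : frob_basis e) v : frob_linear e (fb_map (B := B) v).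
Proof.
split=> [y z|a y].
  rewrite /fb_map -big_split; apply: eq_bigr => i _ /=.
  by have [-> _] := fb_coord_linear i; rewrite mulrDl.
rewrite /fb_map mulr_sumr; apply: eq_bigr => i _ /=.
by have [_ ->] := fb_coord_linear i; rewrite mulrA.
Qed.

Lemma fb_mapE e (B : frob_basis e) f y : frob_linear e f ->
  f y = fb_map (B := B) (fun i => f (fb_elt i)) y.
Proof.
move=> lf; rewrite {1}(fb_coordE B y) (frob_linear_sum _ _ _ lf).
by apply: eq_bigr => i _; case: lf => _ ->.
Qed.

(** ** The dual of [A^{1/q}] as a module over [A^{1/q}] *)

Section Dual.
Variables (e : nat) (B : frob_basis e).
Local Notation n := (fb_rank B).

(** Multiplication by [r] on [A^{1/q}], in the basis. *)
Definition fb_mx (r : A) : 'M[A]_n := \matrix_(i, j) fb_coord B (r * fb_elt i) j.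

Lemma fb_mxD r s : fb_mx (r + s) = fb_mx r + fb_mx s.
Proof.
apply/matrixP => i j; rewrite !mxE mulrDl.
by have [-> _] := fb_coord_linear j.
Qed.

Lemma fb_mxM r s : fb_mx (r * s) = fb_mx s *m fb_mx r.
Proof.
apply/matrixP => i j; rewrite !mxE.
rewrite -mulrA {1}(fb_coordE B (s * fb_elt i)) mulr_sumr.
rewrite (frob_linear_sum _ _ _ (fb_coord_linear j)); apply: eq_bigr => k _.
by have [_ cZ] := fb_coord_linear j; rewrite !mxE mulrCA cZ.
Qed.

Lemma fb_coord_elt i j : fb_coord B (fb_elt i) j = (i == j)%:R.
Proof.
rewrite (fb_coord_unique (c := fun j => (i == j)%:R)) // (bigD1 i) //= eqxx.
rewrite expr1n mul1r big1 ?addr0 // => k /negbTE ki.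
by rewrite eq_sym ki frob0 mul0r.
Qed.

Lemma fb_mx_frob r : fb_mx (r ^+ (p ^ e)) = r%:M.
Proof.
apply/matrixP => i j; rewrite !mxE.
by have [_ ->] := fb_coord_linear j; rewrite fb_coord_elt mulr_natr.
Qed.

Lemma fb_mx1 : fb_mx 1 = 1%:M.
Proof. by have := fb_mx_frob 1; rewrite expr1n. Qed.

(** A column [v] stands for the Frobenius-linear map with values [v i 0] on the
    basis, and [A] acts by premultiplication. *)
Definition dual of p \in [pchar A] : Type := 'cV[A]_n.
Local Notation D := (dual charA).
HB.instance Definition _ := GRing.Zmodule.on D.

Definition dual_scale (r : A) (v : D) : D := fb_mx r *m v.

Fact dual_scaleA r s v : dual_scale r (dual_scale s v) = dual_scale (r * s) v.
Proof. by rewrite /dual_scale mulmxA mulrC fb_mxM. Qed.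
Fact dual_scale1 : left_id 1 dual_scale.
Proof. by move=> v; rewrite /dual_scale fb_mx1 mul1mx. Qed.
Fact dual_scaleDr : right_distributive dual_scale +%R.
Proof. by move=> r u v; rewrite /dual_scale; exact: mulmxDr. Qed.
Fact dual_scaleDl v : {morph dual_scale^~ v : r s / r + s}.
Proof. by move=> r s; rewrite /dual_scale fb_mxD mulmxDl. Qed.

HB.instance Definition _ := GRing.Zmodule_isLmodule.Build A D
  dual_scaleA dual_scale1 dual_scaleDr dual_scaleDl.

Lemma dual_frob_scale r (v : D) : r ^+ (p ^ e) *: v = (r *: (v : 'cV_n) : D).
Proof. by rewrite -[LHS]/(fb_mx _ *m v) fb_mx_frob mul_scalar_mx. Qed.

Lemma dual_delta (v : D) :
  v = \sum_i (v : 'cV_n) i 0 ^+ (p ^ e) *: (delta_mx i 0 : D).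
Proof.
under eq_bigr do rewrite dual_frob_scale.
by rewrite [LHS]matrix_sum_delta; apply: eq_bigr => i _; rewrite big_ord1.
Qed.

Lemma dual_fin_gen : fin_gen D.
Proof.
exists n, (fun i => delta_mx i 0 : D) => v.
by exists (fun i => (v : 'cV_n) i 0 ^+ (p ^ e)); exact: dual_delta.
Qed.

Definition dual_ev (v : D) (y : A) := fb_map (B := B) (fun i => (v : 'cV_n) i 0) y.

Lemma dual_evZ r v y : dual_ev (r *: v) y = dual_ev v (r * y).
Proof.
rewrite /dual_ev /fb_map; under eq_bigr => i _.
  rewrite -[(r *: v : 'cV_n)]/(fb_mx r *m v) mxE mulr_sumr; over.
rewrite exchange_big /=; apply: eq_bigr => k _.
under eq_bigr do rewrite mulrA; rewrite -mulr_suml; congr (_ * _).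
rewrite {2}(fb_coordE B y) mulr_sumr.
rewrite (frob_linear_sum _ _ _ (fb_coord_linear k)); apply: eq_bigr => i _.
by rewrite mulrCA !mxE; case: (fb_coord_linear k) => _ ->.
Qed.

Lemma dual_ev_sum (I : Type) (r : seq I) (F : I -> D) y :
  dual_ev (\sum_(i <- r) F i) y = \sum_(i <- r) dual_ev (F i) y.
Proof.
rewrite /dual_ev /fb_map exchange_big /=; apply: eq_bigr => i _.
by rewrite -mulr_sumr; congr (_ * _); rewrite summxE.
Qed.

Lemma pow_sub_cV d (x : 'I_d -> A) T (v : 'cV[A]_n) :
  pow_sub 'cV[A]_n x (fun=> 1%N) T v <->
  forall i, pow_sub A^o x (fun=> 1%N) T (v i 0).
Proof.
split=> [[w ->] i|].
  by exists (fun k => w k i 0); rewrite summxE; apply: eq_bigr => k _; rewrite !mxE.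
move=> /choice[w wP]; exists (fun k => \col_i w i k).
apply/matrixP => i j; rewrite ord1 wP summxE; apply: eq_bigr => k _.
by rewrite !mxE.
Qed.

Lemma dual_regular d (x : 'I_d -> A) :
  pow_regular A^o x (fun=> 1%N) -> pow_regular D x (fun=> 1%N).
Proof.
move=> regx; apply: (pow_regular_root (a := fun=> (p ^ e)%N)).
  by move=> _; exact: pchar_expn_gt0.
move=> T i iT v.
have subE : pow_sub D x (fun=> (p ^ e)%N) T = pow_sub 'cV[A]_n x (fun=> 1%N) T.
  by apply/seteqP; split=> _ [w ->]; exists w; apply: eq_bigr => k _;
    rewrite dual_frob_scale expr1.
move=> /(pow_subZ (x i ^+ (p ^ e).-1)).
rewrite scalerA -exprSr prednK ?pchar_expn_gt0 // dual_frob_scale subE.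
move=> /pow_sub_cV Tv; apply/pow_sub_cV => k; apply: (regx _ _ iT).
by have := Tv k; rewrite mxE.
Qed.

End Dual.

Lemma F_finite_fin_gen e : F_finite charA -> fin_gen (root_ring charA e).
Proof.
move=> [s sP]; elim: e => [|e [n [g gP]]].
  exists 1%N, (fun=> 1 : root_ring charA 0) => v; exists (fun=> v).
  rewrite big_ord1 -[RHS]/((v : A) ^+ (p ^ 0) * 1).
  by rewrite expn0 expr1 mulr1.
apply: (@fin_gen_finType _ _ ('I_(size s) * 'I_n)%type
  (fun k => (g k.2 : A) ^+ p * s`_k.1 : root_ring charA e.+1)) => v.
have [c vE] := sP v.
have /choice[d dP] : forall i, exists d : 'I_n -> A,
    c i = \sum_j d j *: g j :> root_ring charA e by move=> i; exact: gP.
exists (fun k : 'I_(size s) * 'I_n => d k.1 k.2); rewrite vE.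
rewrite -(pair_bigA _ (fun (i : 'I_(size s)) (j : 'I_n) => d i j *:
  ((g j : A) ^+ p * s`_i : root_ring charA e.+1))) /=.
apply: eq_bigr => i _; rewrite -[LHS]/((c i : A) ^+ (p ^ 1) * s`_i).
rewrite dP -[X in X ^+ _]/(\sum_j (d i j : A) ^+ (p ^ e) * (g j : A)).
rewrite frob_sum mulr_suml; apply: eq_bigr => j _.
rewrite -[RHS]/((d i j : A) ^+ (p ^ e.+1) * ((g j : A) ^+ p * s`_i)).
by rewrite exprMn -exprM -expnSr expn1 mulrA.
Qed.

End FrobeniusLinear.

Arguments frob_linear {A} p e f.
Arguments fb_coord {A p e} f.
Arguments fb_elt {A p e f}.
Arguments dual {A p e} B charA.

Section RegularFrobenius.
Context {R : comNzRingType} {p : nat} (charR : p \in [pchar R]).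
Variable m : set R.
Hypotheses (hreg : regular_local_ring m) (hFfin : F_finite charR).

(** Kunz's theorem.  The parameters act on [R^{1/q}] as their [q]-th powers do on
    [R], hence form a regular sequence. *)
Lemma regular_frob_basis e : inhabited (frob_basis (p := p) (A := R) e).
Proof.
have [d [x parx]] := regular_parameters hreg; have [noeR locR _] := hreg.
have regx := parameters_regular noeR locR parx.
have [|n [b [bP bfree]]] :=
  regular_module_free noeR locR parx (F_finite_fin_gen e hFfin).
  move=> T i iT v; have q_gt0 := pchar_expn_gt0 charR e.
  have subE : pow_sub (root_ring charR e) x (fun=> 1%N) T =
      pow_sub R^o x (fun=> (p ^ e)%N) T.
    apply/seteqP; split=> _ [w ->]; exists w; apply: eq_bigr => k _.
      by rewrite expr1.
    by rewrite -[RHS]/((x k ^+ 1) ^+ (p ^ e) * (w k : R)) expr1.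
  rewrite subE; apply: (nzd_modX (M := R^o) (k := (p ^ e)%N)).
  exact: pow_regular_pow regx _ _ iT.
have [co coP] := choice bP.
exact: (inhabits (@FrobBasis R p e n b co coP bfree)).
Qed.

(** The dual of [R^{1/q}] is free over [R^{1/q}] too: the [q]-th powers of the
    parameters, which act on it as the parameters act on [R ^ n], form a regular
    sequence, hence so do the parameters.  If all values of [z * phi] lie in [J],
    then [z * phi] is a combination of the coordinate maps with coefficients in
    [J^{[q]}], and its coordinates [z * f j] lie in [J^{[q]}]. *)
Lemma regular_dual_basis e : exists N (psi : 'I_N -> R -> R),
  (forall j, frob_linear p e (psi j)) /\
  forall phi, frob_linear p e phi -> exists f : 'I_N -> R,
    (forall y, phi y = \sum_j psi j (f j * y)) /\
    forall (J : set R) z, (forall y, J (phi (z * y))) -> forall j,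
      ideal_gen [set y | exists2 a, J a & y = a ^+ (p ^ e)] (z * f j).
Proof.
have [d [x parx]] := regular_parameters hreg; have [noeR locR _] := hreg.
have regx := parameters_regular noeR locR parx.
have [B] := regular_frob_basis e.
have [N [b [bP bfree]]] := regular_module_free noeR locR parx
  (dual_fin_gen charR B) (dual_regular (charA := charR) (B := B) regx).
pose psi j := fb_map (B := B) (fun i => (b j : 'cV_(fb_rank B)) i 0).
exists N, psi; split=> [j|phi lphi]; first exact: fb_map_linear.
pose vec z : dual B charR := \col_i phi (z * fb_elt i).
have vecM z z' : vec (z * z') = z *: vec z'.
  apply/matrixP => i j; rewrite mxE -[RHS]/((fb_mx B z *m vec z') i j) mxE.
  rewrite (mulrC z) -mulrA {1}(fb_coordE B (z * fb_elt i)) mulr_sumr.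
  rewrite (frob_linear_sum _ _ _ lphi); apply: eq_bigr => k _.
  by rewrite !mxE mulrCA; case: lphi => _ ->.
have [f fE] := bP (vec 1); exists f; split=> [y|J z Jz j].
  transitivity (dual_ev (vec 1) y).
    rewrite (fb_mapE B _ lphi); apply: eq_bigr => i _.
    by rewrite mxE mul1r.
  by rewrite fE dual_ev_sum; apply: eq_bigr => j _; rewrite dual_evZ.
have /choice[g gE] : forall i, exists c : 'I_N -> R,
    (delta_mx i 0 : dual B charR) = \sum_j c j *: b j by move=> i; exact: bP.
have -> : z * f j = \sum_i phi (z * fb_elt i) ^+ (p ^ e) * g i j.
  apply/eqP; rewrite -subr_eq0; apply/eqP.
  apply: (bfree (fun j => z * f j - \sum_i phi (z * fb_elt i) ^+ (p ^ e) * g i j)).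
  under eq_bigr do rewrite scalerBl -scalerA.
  rewrite sumrB -scaler_sumr -fE -vecM mulr1 [vec z]dual_delta.
  apply/eqP; rewrite subr_eq0; apply/eqP.
  under [RHS]eq_bigr do rewrite scaler_suml.
  rewrite exchange_big /=; apply: eq_bigr => i _.
  by rewrite {1}gE scaler_sumr mxE; apply: eq_bigr => k _; rewrite scalerA.
have iG := @ideal_gen_ideal R [set y | exists2 a, J a & y = a ^+ (p ^ e)].
apply: ideal_sum => // i _; rewrite mulrC; apply: (ideal_lmul _ iG).
by apply: sub_ideal_gen; exists (phi (z * fb_elt i)).
Qed.

End RegularFrobenius.

(** * Powers of an ideal and colons *)

(** Hilbert's basis theorem, by the ideals [L n] of coefficients in degree [n] of the
    elements of [J] of degree at most [n]. *)
Lemma noetherian_poly (A : comNzRingType) : noetherian A -> noetherian {poly A}.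
Proof.
move=> noeA J iJ.
pose L n := [set a | exists u : {poly A}, [/\ J u, (size u <= n.+1)%N & a = u`_n]].
have iL n : is_ideal (L n).
  split=> [|_ _ [u [Ju su ->]] [v [Jv sv ->]]|a _ [u [Ju su ->]]].
  - by exists 0; rewrite coef0 size_poly0; split=> //; exact: ideal0.
  - exists (u + v); rewrite coefD; split=> //; first exact: idealD.
    by apply: leq_trans (size_polyD _ _) _; rewrite geq_max su.
  - exists (a%:P * u); rewrite coefCM; split=> //; first exact: ideal_lmul.
    by rewrite mul_polyC; apply: leq_trans (size_scale_leq _ _) _.
have Linc n k : (n <= k)%N -> L n `<=` L k.
  move=> /subnK <-; elim: (k - n)%N => // j IHj a /IHj[u [Ju su ->]].
  exists (u * 'X); rewrite coefMX /=; split=> //; first exact: ideal_rmul.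
  have [->|u0] := eqVneq u 0; first by rewrite mul0r size_poly0.
  by rewrite size_mulX.
have [_ [N ->] [_ maxN]] := @noetherian_max A [set M | exists n, M = L n] (L 0%N) noeA
  (fun M => fun '(ex_intro n E) => eq_ind_r is_ideal (iL n) E)
  (ex_intro _ 0%N erefl).
have LN k : (N <= k)%N -> L k `<=` L N.
  by move=> Nk; rewrite (maxN (L k)) //; [exists k|exact: Linc].
have gens n : exists2 s : seq {poly A}, [set` s] `<=` J & forall a, L n a ->
    exists u, [/\ ideal_gen [set` s] u, (size u <= n.+1)%N & a = u`_n].
  have [t tE] := noeA _ (iL n).
  have /choice[r rP] : forall a, exists u : {poly A}, L n a ->
      [/\ J u, (size u <= n.+1)%N & a = u`_n].
    move=> a; have [[u uP]|] := pselect (L n a); first by exists u.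
    by exists 0.
  have tL a : a \in t -> L n a by move=> ta; rewrite tE; exact: sub_ideal_gen.
  exists [seq r a | a <- t]; first by move=> _ /= /mapP[a /tL/rP[] + _ _ ->].
  move=> a; rewrite {1}tE ideal_gen_seqE => -[c ->].
  have iG := @ideal_gen_ideal _ [set` [seq r a | a <- t]].
  have tnth (i : nat) : (i < size t)%N -> let a := nth 0 t i in
      [/\ J (r a), (size (r a) <= n.+1)%N & a = (r a)`_n].
    by move=> it; apply/rP/tL; rewrite mem_nth.
  exists (\sum_(i < size t) (c i)%:P * r t`_i); split.
  - apply: ideal_sum => // i _; apply: (ideal_lmul _ iG).
    by apply: sub_ideal_gen; rewrite /= map_f // mem_nth.
  - apply: leq_trans (size_sum _ _ _) _; apply/bigmax_leqP => i _.
    rewrite mul_polyC; apply: leq_trans (size_scale_leq _ _) _.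
    by have [] := tnth i (ltn_ord i).
  - rewrite coef_sum; apply: eq_bigr => i _.
    by rewrite coefCM; have [_ _ <-] := tnth i (ltn_ord i).
have [S SJ SL] : exists2 S : seq {poly A}, [set` S] `<=` J & forall n, (n <= N)%N ->
    forall a, L n a -> exists u, [/\ ideal_gen [set` S] u, (size u <= n.+1)%N & a = u`_n].
  suff : forall k, exists2 S : seq {poly A}, [set` S] `<=` J & forall n, (n < k)%N ->
    forall a, L n a -> exists u, [/\ ideal_gen [set` S] u, (size u <= n.+1)%N & a = u`_n].
    by move=> /(_ N.+1).
  elim=> [|k [S SJ SL]]; first by exists [::].
  have [s sJ sL] := gens k; exists (S ++ s).
    by move=> u /=; rewrite mem_cat => /orP[/SJ|/sJ].
  have sub (s1 s2 : seq {poly A}) : {subset s1 <= s2} ->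
      ideal_gen [set` s1] `<=` ideal_gen [set` s2].
    move=> s12; apply: ideal_gen_sub; first exact: ideal_gen_ideal.
    by move=> u us; apply: sub_ideal_gen; exact: s12.
  move=> n; rewrite ltnS leq_eqVlt => /predU1P[->|nk] a.
    move=> /sL[u [su ? ?]]; exists u; split=> //.
    by apply: sub su => v; rewrite mem_cat orbC => ->.
  move=> /(SL _ nk)[u [su ? ?]]; exists u; split=> //.
  by apply: sub su => v; rewrite mem_cat => ->.
have iS := @ideal_gen_ideal _ [set` S].
have SsubJ : ideal_gen [set` S] `<=` J by exact: ideal_gen_sub.
exists S; apply/seteqP; split=> // v; have [n] := ubnP (size v).
elim: n v => // n IHn v; rewrite ltnS => vn Jv.
have [v0|v0] := posnP (size v).
  by move/eqP: v0; rewrite size_poly_eq0 => /eqP ->; exact: ideal0.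
have [k kv] : exists k, size v = k.+1 by exists (size v).-1; rewrite prednK.
suff [u [Su us uv]] : exists u, [/\ ideal_gen [set` S] u, (size u <= k.+1)%N & v`_k = u`_k].
  rewrite -(subrK u v); apply: (idealD iS) => //; apply: IHn; last first.
    by apply: idealB => //; exact: SsubJ.
  rewrite (leq_trans _ vn) // kv ltnS; apply/leq_sizeP => j.
  rewrite leq_eqVlt coefB => /predU1P[<-|kj]; first by rewrite uv subrr.
  by rewrite !nth_default ?subrr // ?kv // (leq_trans us).
have Lk : L k v`_k by exists v; rewrite kv; split.
have [kN|/ltnW Nk] := leqP k N; first exact: SL kN _ Lk.
have [u [Su us uv]] := SL N (leqnn N) _ (LN _ Nk _ Lk).
exists (u * 'X^(k - N)); split.
- exact: (ideal_rmul _ iS).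
- apply: leq_trans (size_polyMleq _ _) _; rewrite size_polyXn.
  by move: us Nk; clear; move: (size u) => n; lia.
- by rewrite coefMXn ltnNge leq_subr /= subKn.
Qed.

(** An iterated polynomial ring serves as [B]; the last clause says that the image of
    [g] is no larger than the subalgebra generated by [l]. *)
Lemma poly_subalgebra_noetherian (A : comNzRingType) (l : seq {poly A}) :
  noetherian A -> exists (B : comNzRingType) (g : {rmorphism B -> {poly A}}),
  [/\ noetherian B, forall c, exists b, g b = c%:P,
      forall y, y \in l -> exists b, g b = y &
      forall E : set {poly A}, (forall u v, E u -> E v -> E (u + v)) ->
        (forall u v, E u -> E v -> E (u * v)) -> (forall c, E c%:P) ->
        (forall y, y \in l -> E y) -> forall b, E (g b)].
Proof.
move=> noeA; elim: l => [|y l [B [g [noeB gC gl gE]]]].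
  exists A, (polyC : {rmorphism A -> {poly A}}).
  by split=> // c; exists c.
have cgy : commr_rmorph g y by move=> b; exact: mulrC.
exists {poly B}, (horner_morph cgy : {rmorphism {poly B} -> {poly A}}); split.
- exact: noetherian_poly.
- by move=> c; have [b bc] := gC c; exists b%:P; rewrite /= horner_morphC.
- move=> z; rewrite inE => /predU1P[->|/gl[b <-]].
    by exists 'X; rewrite /= horner_morphX.
  by exists b%:P; rewrite /= horner_morphC.
- move=> E ED EM EC El u; have Ey : E y by apply: El; rewrite mem_head.
  have Eg b : E (g b).
    by apply: gE => // z zl; apply: El; rewrite inE zl orbT.
  elim/poly_ind: u => [|u c IHu]; first by rewrite rmorph0 -[0](polyC0); exact: EC.
  rewrite rmorphD rmorphM /= horner_morphX horner_morphC.
  by apply: ED => //; exact: EM.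
Qed.

Section IdealPowers.
Context {A : comNzRingType}.
Hypothesis noeA : noetherian A.
Variable I : set A.
Hypothesis iI : is_ideal I.

(** The Rees algebra [A[It]] of [I] is a finitely generated subalgebra of [A[t]], so its
    ideal with graded pieces [N k] is generated by elements of bounded degree. *)
Lemma rees_stable (N : nat -> set A) : (forall k, is_ideal (N k)) ->
  (forall k, N k `<=` ideal_exp I k) ->
  (forall k a b, I a -> N k b -> N k.+1 (a * b)) ->
  exists k0, forall k, (k0 <= k)%N -> N k.+1 `<=` ideal_mul I (N k).
Proof.
move=> iN NI IN; have [s sE] := noeA iI.
have [B [g [noeB gC gl gE]]] :=
  poly_subalgebra_noetherian [seq x *: 'X | x <- s] noeA.
have iE k := ideal_exp_ideal I k.
have gI b k : ideal_exp I k (g b)`_k.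
  apply: (gE [set u : {poly A} | forall k, ideal_exp I k u`_k]) => [u v Eu Ev j|u v Eu Ev j|c j|].
  - by rewrite coefD; exact: idealD.
  - rewrite coefM; apply: ideal_sum => // i _.
    have := ideal_expD (Eu i) (Ev (j - i)%N).
    by rewrite subnKC // -ltnS.
  - by rewrite coefC; case: eqP => [->|_] //; exact: ideal0.
  - move=> _ /mapP[x xs ->] j; rewrite coefZ coefX.
    case: eqP => [->|_]; last by rewrite mulr0; exact: ideal0.
    by rewrite mulr1; apply: ideal_exp1; rewrite sE; exact: sub_ideal_gen.
have IkN j k a b : ideal_exp I j a -> N k b -> N (j + k)%N (a * b).
  move=> + Nb; suff: ideal_exp I j `<=` ideal_colon (N (j + k)%N) b by exact.
  elim: j => [|j IHj]; first by move=> c _; exact: ideal_lmul.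
  apply: ideal_mul_ind => [|u v Iu /IHj Nvb]; first exact: ideal_colon_ideal.
  by rewrite /ideal_colon /= -mulrA; exact: IN.
have iXk k : is_ideal [set v | exists b, g b = v *: 'X^k].
  split=> [|u v [b bu] [c cv]|c u [b bu]].
  - by exists 0; rewrite rmorph0 scale0r.
  - by exists (b + c); rewrite rmorphD bu cv scalerDl.
  - by have [d dc] := gC c; exists (d * b); rewrite rmorphM dc bu mul_polyC scalerA.
have gX k v : ideal_exp I k v -> exists b, g b = v *: 'X^k.
  elim: k v => [|k IHk] v.
    by have [b bv] := gC v; exists b; rewrite bv expr0 alg_polyC.
  suff: ideal_exp I k.+1 `<=` [set v | exists b, g b = v *: 'X^(k.+1)] by exact.
  apply: ideal_mul_ind => // x y Ix /IHk[b bE].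
  have [c cE] : exists c, g c = x *: 'X^1.
    suff: I `<=` [set v | exists b, g b = v *: 'X^1] by exact.
    rewrite sE; apply: ideal_gen_sub => // z zs.
    by have [c cz] := gl _ (map_f (fun x => x *: 'X) zs); exists c; rewrite cz expr1.
  exists (c * b); rewrite rmorphM cE bE -scalerAl -scalerAr scalerA.
  by rewrite -exprD.
(* [J] is pulled back to the noetherian ring [B]. *)
pose J : set B := [set b | forall k, N k (g b)`_k].
have iJ : is_ideal J.
  split=> [k|u v Ju Jv k|c u Ju k].
  - by rewrite rmorph0 coef0; exact: ideal0.
  - by rewrite rmorphD coefD; exact: idealD.
  - rewrite rmorphM coefM; apply: ideal_sum => // i _.
    have := IkN _ _ _ _ (gI c i) (Ju (k - i)%N).
    by rewrite subnKC // -ltnS.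
have [t tE] := noeB _ iJ.
exists (\max_(i < size t) size (g t`_i)%R)%N => k kD v Nv.
have [b bE] := gX _ _ (NI _ _ Nv).
have : J b.
  move=> j; rewrite bE coefZ coefXn; case: eqP => [->|_]; first by rewrite mulr1.
  by rewrite mulr0; exact: ideal0.
rewrite tE ideal_gen_seqE => -[c bsum].
have -> : v = (g b)`_k.+1 by rewrite bE coefZ coefXn eqxx mulr1.
rewrite bsum rmorph_sum coef_sum.
apply: ideal_sum => [|i _]; first exact: ideal_mul_ideal.
rewrite rmorphM coefM; apply: ideal_sum => [|j _]; first exact: ideal_mul_ideal.
have [szij|kij] := leqP (size (g t`_i)) (k.+1 - j).
  by rewrite (nth_default 0 szij) mulr0; apply: ideal0; exact: ideal_mul_ideal.
have j_gt0 : (0 < j)%N.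
  have := leq_bigmax (F := fun i : 'I_(size t) => size (g t`_i)) i.
  by move=> szD; have := leq_trans kij (leq_trans szD kD); clear; lia.
have Nt : N (k.+1 - j)%N (g t`_i)`_(k.+1 - j).
  suff : J t`_i by apply.
  by rewrite tE; apply: sub_ideal_gen; rewrite /= mem_nth.
have := gI (c i) j; case: (j : nat) j_gt0 Nt (ltn_ord j) => // j' _ Nt j'k.
rewrite subSS in Nt *.
suff: ideal_exp I j'.+1 `<=` ideal_colon (ideal_mul I (N k)) (g t`_i)`_(k - j') by exact.
apply: ideal_mul_ind => [|x y Ix Iy].
  by apply: ideal_colon_ideal; exact: ideal_mul_ideal.
rewrite /ideal_colon /= -mulrA; apply: ideal_mulP => //.
by have := IkN _ _ _ _ Iy Nt; rewrite subnKC // -ltnS ltnW.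
Qed.

(** Multiplication by [x] embeds the colons [I^{k+1} : I] into the Rees algebra as a
    graded ideal.  For large [k] the colon in degree [k] is therefore [I] times the
    previous one [I^k : I], and [I * (I^k : I) <= I^k]. *)
Lemma colon_exp x : I x -> (forall a, x * a = 0 -> a = 0) ->
  exists k0, forall k, (k0 <= k)%N -> forall f,
    (forall y, I y -> ideal_exp I k.+1 (f * y)) -> ideal_exp I k f.
Proof.
move=> Ix nzx.
pose N k := [set z | exists2 f, forall y, I y -> ideal_exp I k (f * y) & z = f * x].
have iE k := ideal_exp_ideal I k.
have [k|k _ [f If ->]|k a _ Ia [f If ->]|k0 k0P] := @rees_stable N.
- split=> [|_ _ [f If ->] [f' If' ->]|a _ [f If ->]].
  + by exists 0; rewrite ?mul0r // => y _; rewrite mul0r; exact: ideal0.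
  + exists (f + f'); last by rewrite mulrDl.
    by move=> y Iy; rewrite mulrDl; apply: idealD; [|exact: If|exact: If'].
  + exists (a * f); last by rewrite mulrA.
    by move=> y Iy; rewrite -mulrA; apply: ideal_lmul => //; exact: If.
- exact: If.
- exists (a * f); last by rewrite mulrA.
  by move=> y Iy; rewrite -mulrA; apply: ideal_mulP => //; exact: If.
exists k0 => k /k0P kP f If; have : N k.+1 (f * x) by exists f.
move/kP; suff: ideal_mul I (N k) `<=` [set z | exists2 w, ideal_exp I k w & z = w * x].
  move=> /[apply] -[w Iw /eqP]; rewrite -subr_eq0 -mulrBl mulrC => /eqP/nzx/eqP.
  by rewrite subr_eq0 => /eqP ->.
apply: ideal_mul_ind => [|a _ Ia [f' If' ->]].
  split=> [|_ _ [u Iu ->] [v Iv ->]|a _ [u Iu ->]].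
  - by exists 0; rewrite ?mul0r //; exact: ideal0.
  - by exists (u + v); rewrite ?mulrDl //; exact: idealD.
  - by exists (a * u); rewrite ?mulrA //; exact: ideal_lmul.
by exists (f' * a); [exact: If'|rewrite mulrA (mulrC a)].
Qed.

End IdealPowers.

(** * Frobenius powers of a prime of height [h] *)

Lemma pow_sub_nth (A : comNzRingType) (s : seq A) :
  pow_sub A^o (fun i : 'I_(size s) => s`_i) (fun=> 1%N) finset.setT = ideal_gen [set` s].
Proof.
rewrite ideal_gen_seqE; apply/seteqP; split=> v.
  move=> [w ->]; exists (fun i => if insub i is Some k then w k else 0).
  rewrite big_mkcond; apply: eq_bigr => i _; rewrite inE expr1 valK.
  exact: mulrC.
move=> [w ->]; exists (fun i => w i); rewrite [RHS]big_mkcond; apply: eq_bigr => i _.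
by rewrite inE expr1; exact: mulrC.
Qed.

(** The [j]-th element is chosen in [P] outside those minimal primes of the previous
    ones that have height [j - 1]; every prime between the first [j] elements and [P]
    then has height at least [j], and for [j = h] it is [P]. *)
Lemma height_parameters (A : comNzRingType) (P : set A) h : noetherian A ->
  is_prime P -> prime_height P h ->
  exists y : 'I_h -> A, minimal_prime_of (pow_sub A^o y (fun=> 1%N) finset.setT : set A) P.
Proof.
move=> noeA pP [[c [cp cS] ch] hmax].
suff [ys [sys ysP Hys]] : exists ys : seq A, [/\ size ys = h,
    ideal_gen [set` ys] `<=` P & forall Q, is_prime Q -> ideal_gen [set` ys] `<=` Q ->
    Q `<=` P -> exists2 c, prime_chain c h & c h = Q].
  move: sys => <- in Hys hmax *; exists (fun i => ys`_i).
  rewrite pow_sub_nth; split=> // Q pQ ysQ QP; apply: contrapT => neq.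
  have [c' [c'p c'S] c'Q] := Hys _ pQ ysQ QP.
  suff chain : prime_chain (fun i => if (i <= size ys)%N then c' i else P) (size ys).+1.
    by have := hmax _ _ chain; rewrite !ltnn => /(_ erefl).
  split=> i.
    by rewrite leq_eqVlt => /predU1P[->|]; rewrite ?ltnn // ltnS => il; rewrite il; exact: c'p.
  rewrite ltnS leq_eqVlt => /predU1P[->|il].
    rewrite eqxx /= ltnn c'Q; split=> // PQ; apply: neq.
    by apply/seteqP.
  by rewrite il orbT; exact: c'S.
suff : forall j, (j <= h)%N -> exists ys : seq A, [/\ size ys = j,
    ideal_gen [set` ys] `<=` P & forall Q, is_prime Q -> ideal_gen [set` ys] `<=` Q ->
    Q `<=` P -> exists2 c, prime_chain c j & c j = Q] by apply.
elim=> [_|j IHj jh].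
  exists [::]; rewrite ideal_gen_nil; split=> // [_ ->|Q pQ _ _].
    by apply: ideal0; exact: prime_ideal.
  by exists (fun=> Q) => //; split.
have [ys [sys ysP Hys]] := IHj (ltnW jh).
have iys := @ideal_gen_ideal A [set` ys].
have [l lmin lcov] := noetherian_minimal_primes noeA iys.
have iP := prime_ideal pP.
pose low Q := Q `<=` P /\ ~ exists2 c, prime_chain c j.+1 & c j.+1 = Q.
have [||y Py avy] := @prime_avoidance A P 0 [seq Q <- l | `[< low Q >]] iP.
- by move=> Q; rewrite mem_filter => /andP[_ /lmin[]].
- move=> Q; rewrite mem_filter => /andP[/asboolP[QP noc] _] [_ PQ]; apply: noc.
  have -> : Q = P by apply/seteqP.
  exists (fun i => c (i + (h - j.+1))%N); last by rewrite subnKC.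
  split=> i ij; first by apply: cp; lia.
  by rewrite addSn; apply: cS; lia.
exists (y :: ys); rewrite /= sys ideal_gen_cons; split=> //.
  exact: ideal_adj_sub.
move=> Q pQ ysQ QP.
have ysQ' : ideal_gen [set` ys] `<=` Q by apply: subset_trans ysQ; exact: sub_ideal_adj.
have [Q0 Q0l Q0Q] := lcov _ pQ ysQ'; have [pQ0 ysQ0 _] := lmin _ Q0l.
have Q0P := subset_trans Q0Q QP.
have [[c' [c'p c'S] c'Q]|noc] := pselect (exists2 c, prime_chain c j.+1 & c j.+1 = Q0).
  exists (fun i => if i == j.+1 then Q else c' i); last by rewrite eqxx.
  split=> i ij; first by case: eqP => // _; exact: c'p.
  rewrite (ltn_eqF ij); have [cs ncs] := c'S _ ij; case: eqP => [E|//].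
  rewrite E c'Q in cs ncs; split; first exact: subset_trans cs Q0Q.
  by move=> Qc; apply: ncs; exact: subset_trans Q0Q Qc.
have [c' [c'p c'S] c'Q] := Hys _ pQ0 ysQ0 Q0P.
have nQ0y : ~ Q0 y.
  by have := avy Q0; rewrite add0r mem_filter Q0l andbT; apply; apply/asboolP.
exists (fun i => if (i <= j)%N then c' i else Q); last by rewrite ltnn.
split=> i; first by case: (leqP i j) => // ij _; exact: c'p.
rewrite ltnS leq_eqVlt => /predU1P[->|ij].
  rewrite eqxx /= ltnn c'Q; split=> // /(_ y) QQ0; apply: nQ0y; apply: QQ0.
  by apply: ysQ; exact: ideal_adj_mem.
by rewrite ij orbT; exact: c'S.
Qed.

Section PowerIdeals.
Context {A : comNzRingType} {d : nat}.
Variables (P : set A) (x : 'I_d -> A).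
Hypothesis pP : is_prime P.
Implicit Types (a : 'I_d -> nat).

Local Notation Ix a := (pow_sub A^o x a finset.setT : set A).

Lemma pow_ideal a : is_ideal (Ix a).
Proof. by split=> [|u v|c u]; [exact: pow_sub0|exact: pow_subD|exact: pow_subZ]. Qed.

Lemma pow_ideal_mem a l : Ix a (x l ^+ a l).
Proof.
apply/(pow_subD1 _ _ _ (finset.in_setT l)); exists 0; first exact: pow_sub0.
by exists 1; rewrite addr0; exact/esym/mulr1.
Qed.

Lemma pow_ideal_sub a J : is_ideal J -> (forall l, J (x l ^+ a l)) -> Ix a `<=` J.
Proof.
by move=> iJ xJ _ [w ->]; apply: ideal_sum => // i _; exact: ideal_rmul.
Qed.

Lemma pow_ideal_mulr a l v : (0 < a l)%N ->
  Ix (upd_exp a l (a l).-1) v -> Ix a (v * x l).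
Proof.
move=> al /(pow_subD1 _ _ _ (finset.in_setT l)); rewrite upd_expE.
rewrite pow_sub_upd ?inE ?eqxx // => -[u Tu [w ->]].
apply/(pow_subD1 _ _ _ (finset.in_setT l)); exists (x l * u); first exact: pow_subZ.
exists w; rewrite mulrDl; congr (_ + _); last exact: mulrC.
by rewrite -[X in X * _]/(_ * _) mulrAC -exprSr prednK.
Qed.

Lemma pow_ideal_upd1 a l : (0 < a l)%N -> Ix a `<=` Ix (upd_exp a l 1).
Proof.
move=> al; apply: pow_ideal_sub => [|i]; first exact: pow_ideal.
have := pow_ideal_mem (upd_exp a l 1) i; rewrite {2}/upd_exp; case: eqP => [->|_] //.
rewrite expr1 => Ixl; rewrite -(prednK al) exprSr.
exact: (ideal_lmul _ (pow_ideal _)).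
Qed.

Lemma pow_ideal_adj a l : (0 < a l)%N -> ideal_adj (Ix a) (x l) = Ix (upd_exp a l 1).
Proof.
move=> al; have iI := pow_ideal (upd_exp a l 1); apply/seteqP; split.
  apply: ideal_adj_sub => //; first exact: pow_ideal_upd1.
  by have := pow_ideal_mem (upd_exp a l 1) l; rewrite upd_expE.
have iJ := ideal_adj_ideal (x l) (pow_ideal a).
apply: pow_ideal_sub => // i; rewrite {1}/upd_exp; case: eqP => [->|_].
  by rewrite expr1; apply: ideal_adj_mem; exact: pow_ideal.
by apply: sub_ideal_adj; exact: pow_ideal_mem.
Qed.

(** The two smaller exponents come from additivity of length along
    [0 -> A/(x_l^(k-1), ...) -> A/(x_l^k, ...) -> A/(x_l, ...) -> 0]. *)
Lemma exponent_ind (H : ('I_d -> nat) -> Prop) :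
  (forall a, (forall i, a i = 1%N) -> H a) ->
  (forall a l, (forall i, 0 < a i)%N -> (1 < a l)%N ->
    H (upd_exp a l 1) -> H (upd_exp a l (a l).-1) -> H a) ->
  forall a, (forall i, 0 < a i)%N -> H a.
Proof.
move=> H1 HS a; have [n] := ubnP (\sum_i a i)%N.
elim: n a => // n IHn a; rewrite ltnS => an a_gt0.
have [/existsP[l al]|no] := boolP [exists l, (1 < a l)%N]; last first.
  apply: H1 => i; apply/eqP; rewrite eqn_leq a_gt0 andbT leqNgt; apply/negP => ai.
  by case/existsP: no; exists i.
have small k : (0 < k < a l)%N -> H (upd_exp a l k).
  move=> /andP[k0 kal]; apply: IHn; last exact: upd_exp_gt0.
  apply: leq_trans an; rewrite (bigD1 l) //= [ltnRHS](bigD1 l) //= upd_expE.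
  rewrite (eq_bigr a); first by rewrite ltn_add2r.
  by move=> j; rewrite /upd_exp => /negbTE ->.
by apply: (HS a l) => //; apply: small; [rewrite al|lia].
Qed.

Lemma prod_upd_exp a l : (1 < a l)%N ->
  (\prod_i a i = \prod_i upd_exp a l 1 i + \prod_i upd_exp a l (a l).-1 i)%N.
Proof.
move=> al; have E k : (\prod_i upd_exp a l k i = k * \prod_(i | i != l) a i)%N.
  rewrite (bigD1 l) //= upd_expE; congr muln; apply: eq_bigr => i.
  by rewrite /upd_exp => /negbTE ->.
by rewrite !E (bigD1 l) //= mul1n -mulSn prednK // ltnW.
Qed.

Lemma length_le_pow N : (forall n, length_ge P (Ix (fun=> 1%N)) n -> (n <= N)%N) ->
  forall a, (forall i, 0 < a i)%N ->
  forall n, length_ge P (Ix a) n -> (n <= (\prod_i a i) * N)%N.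
Proof.
move=> bound; apply: exponent_ind => [a a1 n|a l a_gt0 al IH1 IH2 n].
  rewrite (@eq_pow_sub _ _ _ _ a (fun=> 1%N)) => [/bound|i _]; last exact: a1.
  by rewrite big1 ?mul1n.
move=> /(length_ge_sub (x l) pP (pow_ideal a))[b [c [nbc Lb Lc]]].
rewrite (prod_upd_exp al) mulnDl (leq_trans nbc) // leq_add //.
  by apply: IH1; rewrite -pow_ideal_adj // ltnW.
apply: IH2; apply: length_ge_anti Lc => v Iv.
by apply: pow_ideal_mulr => //; exact: ltnW.
Qed.

(** Lech's notion of independence, over the localisation at [P]. *)
Definition lech_indep a := forall c : 'I_d -> A,
  \sum_i x i ^+ a i * c i = 0 -> forall i, sat P (Ix a) (c i).

Lemma lech_colon a l r : (0 < a l)%N -> lech_indep a -> Ix a (r * x l) ->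
  sat P (Ix (upd_exp a l (a l).-1)) r.
Proof.
move=> al ind [w rxE]; set a' := upd_exp a l _.
have iIa' := pow_ideal a'.
have Iaa' : Ix a `<=` Ix a'.
  apply: pow_ideal_sub => // i; have := pow_ideal_mem a' i; rewrite {2}/a' /upd_exp.
  case: eqP => [->|//] Ial; rewrite -(prednK al) exprSr.
  exact: (ideal_rmul _ iIa').
have Ir : sat P (Ix a) (r - x l ^+ (a l).-1 * w l).
  pose c i := if i == l then r - x l ^+ (a l).-1 * w l else - (x l ^+ (a l).-1 * w i).
  suff /ind/(_ l) : \sum_i x i ^+ a i * c i = 0 by rewrite /c eqxx.
  rewrite (bigD1 l) //= /c eqxx.
  have -> : \sum_(i | i != l) x i ^+ a i *
      (if i == l then r - x l ^+ (a l).-1 * w l else - (x l ^+ (a l).-1 * w i)) =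
      - (x l ^+ (a l).-1 * (\sum_(i | i != l) x i ^+ a i * w i)).
    rewrite mulr_sumr -sumrN; apply: eq_bigr => i /negbTE ->.
    by rewrite mulrN mulrCA.
  have -> : \sum_(i | i != l) x i ^+ a i * w i = r * x l - x l ^+ a l * w l.
    rewrite rxE [X in _ = X - _](bigD1 l) ?inE //= -[x l ^+ a l *: w l]/(x l ^+ a l * w l).
    rewrite [X in X - _]addrC addrK.
    by apply: eq_big => [i|//]; rewrite ?inE.
  have -> : x l ^+ a l = x l ^+ (a l).-1 * x l by rewrite -exprSr prednK.
  by ring.
rewrite -(subrK (x l ^+ (a l).-1 * w l) r); apply: idealD; first exact: sat_ideal.
  exact: sat_mono Ir.
apply: (sub_sat pP); apply: ideal_rmul => //.
by have := pow_ideal_mem a' l; rewrite {2}/a' upd_expE.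
Qed.

Lemma lech_pred a l : (1 < a l)%N -> lech_indep a ->
  lech_indep (upd_exp a l (a l).-1).
Proof.
move=> al ind c cE i; have al0 := ltnW al.
have iIa' := pow_ideal (upd_exp a l (a l).-1).
have Iaa' : Ix a `<=` Ix (upd_exp a l (a l).-1).
  apply: pow_ideal_sub => // j; have := pow_ideal_mem (upd_exp a l (a l).-1) j.
  rewrite {2}/upd_exp; case: eqP => [->|//] Ial; rewrite -(prednK al0) exprSr.
  exact: (ideal_rmul _ iIa').
have H : \sum_i x i ^+ a i * (if i == l then c i else c i * x l) = 0.
  have E := congr1 (fun v => v * x l) cE; rewrite mul0r mulr_suml in E.
  rewrite -[RHS]E.
  apply: eq_bigr => j _; rewrite /upd_exp; case: eqP => [->|_].
    by rewrite mulrAC -exprSr prednK.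
  by rewrite mulrA.
have := ind _ H i; case: eqP => [->|_]; first exact: sat_mono.
move=> [s ns Isc].
apply: (sat_idem pP); exists s => //; apply: lech_colon => //.
by rewrite -mulrA.
Qed.

Lemma lech_indep1 a l : (0 < a l)%N -> lech_indep a -> lech_indep (upd_exp a l 1).
Proof.
have [n] := ubnP (a l); elim: n a => // n IHn a; rewrite ltnS => an al ind.
have [al1|al1] := leqP (a l) 1.
  have al1' : a l = 1%N by apply/eqP; rewrite eqn_leq al1.
  have E : upd_exp a l 1 =1 a by move=> i; rewrite /upd_exp; case: eqP => // ->.
  move=> c cE i; rewrite (@eq_pow_sub _ _ _ _ _ a) => [|j _]; last exact: E.
  by apply: ind; under eq_bigr do rewrite -E.
have E : upd_exp (upd_exp a l (a l).-1) l 1 =1 upd_exp a l 1.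
  by move=> i; rewrite /upd_exp; case: eqP.
have /IHn : lech_indep (upd_exp a l (a l).-1) by exact: lech_pred.
rewrite upd_expE => IH c cE i; rewrite -(@eq_pow_sub _ _ _ _ _ _ _ (fun j _ => E j)).
apply: IH; [|by lia|by under eq_bigr do rewrite E].
by rewrite prednK.
Qed.

Lemma length_ge_pow a : (forall l, P (x l)) -> (forall i, 0 < a i)%N ->
  lech_indep a -> length_ge P (Ix a) (\prod_i a i)%N.
Proof.
move=> Px; move: a; apply: exponent_ind => [a a1 _|a l a_gt0 al IH1 IH2 ind].
  rewrite big1 //; apply: (LengthGeS (x := 1)); last exact: LengthGe0.
  move=> [s ns]; rewrite mulr1 => Is; apply: ns; move: Is.
  apply: pow_ideal_sub => [|i]; first exact: prime_ideal.
  by rewrite a1 expr1.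
have al0 := ltnW al.
rewrite (prod_upd_exp al) addnC.
apply: (@length_ge_add A P (Ix a) (Ix (upd_exp a l (a l).-1)) (x l) _ _ pP
  (pow_ideal a) (pow_ideal _)).
- by move=> r; exact: lech_colon.
- by rewrite pow_ideal_adj //; apply: IH1; exact: lech_indep1.
- by apply: IH2; exact: lech_pred.
Qed.

(** A monomial of degree exceeding the sum of the [a i - 1] is divisible by some
    [x i ^+ a i]. *)
Lemma pow_ideal_pigeonhole N a : (forall i, 0 < a i)%N ->
  (\sum_i (a i).-1 < N)%N -> ideal_exp (Ix (fun=> 1%N)) N `<=` Ix a.
Proof.
elim: N a => // N IHN a a_gt0; rewrite ltnS => aN.
apply: ideal_mul_ind => [|u v [w ->] xv]; first exact: pow_ideal.
rewrite mulr_suml; apply: ideal_sum => [|l _]; first exact: pow_ideal.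
have -> : (x l ^+ 1 *: w l) * v = w l * (v * x l).
  by rewrite expr1 -[_ *: _]/(_ * _); ring.
apply: (ideal_lmul _ (pow_ideal a)).
have [al|al] := leqP (a l) 1.
  apply: (ideal_lmul _ (pow_ideal a)).
  have al1 : a l = 1%N by apply/eqP; rewrite eqn_leq al a_gt0.
  by have := pow_ideal_mem a l; rewrite al1 expr1.
apply: pow_ideal_mulr; first exact: ltnW.
apply: IHN => //; first by apply: upd_exp_gt0 => //; lia.
apply: leq_trans aN; rewrite (bigD1 l) //= [ltnRHS](bigD1 l) //= upd_expE.
rewrite (eq_bigr (fun i => (a i).-1)); first by rewrite ltn_add2r; lia.
by move=> j; rewrite /upd_exp => /negbTE ->.
Qed.

End PowerIdeals.

Lemma length_ge_sat (A : comNzRingType) (P J : set A) n : is_prime P -> is_ideal J ->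
  length_ge P J n -> length_ge P (sat P J) n.
Proof.
move=> pP + L; elim: L => [J1|J1 x {}n nx _ IH] iJ; first exact: LengthGe0.
apply: (@LengthGeS _ _ _ x); first by move=> /(sat_idem pP).
apply: length_ge_anti (IH (ideal_adj_ideal x iJ)).
apply: ideal_adj_sub; first exact/sat_ideal/ideal_adj_ideal.
  by apply: sat_mono; exact: sub_ideal_adj.
by apply: (sub_sat pP); exact: ideal_adj_mem.
Qed.

Section RegularPrimes.
Context {R : comNzRingType} {p : nat} (charR : p \in [pchar R]).
Variable m : set R.
Hypotheses (hreg : regular_local_ring m) (hFfin : F_finite charR).
Variables (P : set R) (h : nat).
Hypotheses (pP : is_prime P) (htP : prime_height P h).

Let noeR : noetherian R. Proof. by case: hreg. Qed.
Let iP : is_ideal P. Proof. exact: prime_ideal. Qed.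

Lemma pow_ideal_frob d (x : 'I_d -> R) e v : pow_sub R^o x (fun=> 1%N) finset.setT v ->
  pow_sub R^o x (fun=> p ^ e)%N finset.setT (v ^+ (p ^ e)).
Proof.
move=> [w ->]; exists (fun i => w i ^+ (p ^ e)).
rewrite (frob_sum charR); apply: eq_bigr => i _.
by rewrite expr1; exact: exprMn.
Qed.

(** In a local generating family of the smallest size, a relation with a coefficient
    outside [P] would make one generator redundant. *)
Lemma local_minimal_generators : exists n (x : 'I_n -> R), [/\ forall l, P (x l),
  P `<=` sat P (pow_sub R^o x (fun=> 1%N) finset.setT) &
  forall c : 'I_n -> R, \sum_i x i * c i = 0 -> forall i, P (c i)].
Proof.
have exn : exists n, `[< exists x : 'I_n -> R, (forall l, P (x l)) /\
    P `<=` sat P (pow_sub R^o x (fun=> 1%N) finset.setT) >].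
  have [s sE] := noeR iP; exists (size s); apply/asboolP.
  exists (fun i => s`_i); rewrite pow_sub_nth; split=> [l|].
    by rewrite sE; apply: sub_ideal_gen; rewrite /= mem_nth.
  by rewrite {1}sE; exact: sub_sat.
case: (ex_minnP exn) => n /asboolP[x [Px Psat]] minn; exists n, x; split=> // c cE i.
apply: contrapT => nPc; case: n => [|n] in x Px Psat minn c cE i nPc exn *.
  by case: i nPc.
have : (n < n)%N; last by rewrite ltnn.
apply: minn; apply/asboolP; exists (fun k => x (lift i k)); split=> //.
set J := (X in _ `<=` sat P X).
have iJ : is_ideal J by exact: pow_ideal.
have memJ k : J (x (lift i k)).
  by have := pow_ideal_mem (fun k => x (lift i k)) (fun=> 1%N) k; rewrite expr1.
suff sub : pow_sub R^o x (fun=> 1%N) finset.setT `<=` sat P J.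
  by move=> v /Psat /(sat_mono sub) /(sat_idem pP).
apply: pow_ideal_sub => [|l]; first exact: sat_ideal.
rewrite expr1; have [k ->|->] := unliftP i l; first exact: (sub_sat pP).
exists (c i) => //; move: cE; rewrite (bigD1_ord i) //= mulrC => /eqP.
rewrite addr_eq0 => /eqP ->; apply: idealN => //; apply: ideal_sum => // k _.
exact: ideal_rmul.
Qed.

(** Kunz's converse theorem, that flatness of the Frobenius makes [R_P] regular.  By
    flatness the [q]-th powers of minimal generators of [P R_P] are independent in
    Lech's sense, so that [P^{[q]}] has colength at least [q ^ n]; it contains the
    [q]-th powers of [h] elements over which [P] is minimal, and the ideal of these
    powers has colength [O(q ^ h)]. *)
Lemma regular_prime_generators : exists n (x : 'I_n -> R), [/\ (n <= h)%N,
  forall l, P (x l) & P `<=` sat P (pow_sub R^o x (fun=> 1%N) finset.setT)].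
Proof.
have [n [x [Px Psat minx]]] := local_minimal_generators.
exists n, x; split=> //; have [y miny] := height_parameters noeR pP htP.
have [_ yP _] := miny.
have iy := pow_ideal y; have ix := pow_ideal x.
have [N bound] : exists N, forall k,
    length_ge P (pow_sub R^o y (fun=> 1%N) finset.setT) k -> (k <= N)%N.
  apply: length_finite => // v Pv.
  have [k [s ns Jv]] := minimal_prime_nilpotent noeR (iy _) miny Pv.
  by exists k, s.
have frobP e v : P v -> sat P (pow_sub R^o x (fun=> p ^ e)%N finset.setT) (v ^+ (p ^ e)).
  move=> /Psat[s ns Jsv]; exists (s ^+ (p ^ e)); first exact: primeXN.
  by rewrite -exprMn; exact: pow_ideal_frob.
have ind e : lech_indep P x (fun=> p ^ e)%N.
  have [B] := regular_frob_basis hreg hFfin e => c cE i.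
  have Pc k : P (fb_coord B (c i) k).
    apply: (minx (fun i => fb_coord B (c i) k)).
    have lk := fb_coord_linear charR (B := B) k.
    rewrite -[RHS](frob_linear0 lk) -[X in _ = fb_coord B X k]cE.
    rewrite (frob_linear_sum _ _ _ lk).
    by apply: eq_bigr => j _; case: lk => _ ->.
  rewrite (fb_coordE B (c i)).
  have iS := sat_ideal pP (ix (fun=> p ^ e)%N).
  apply: ideal_sum => // k _; apply: (ideal_rmul _ iS); exact: frobP.
have key e : ((p ^ e) ^ n <= (p ^ e) ^ h * N)%N.
  have q_gt0 : forall d (i : 'I_d), (0 < p ^ e)%N by move=> *; exact: (pchar_expn_gt0 charR).
  have := length_ge_pow pP Px (q_gt0 n) (ind e); rewrite prod_nat_const card_ord.
  move=> /(length_ge_sat pP (ix _)) Lx.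
  have sub : pow_sub R^o y (fun=> p ^ e)%N finset.setT `<=`
      sat P (pow_sub R^o x (fun=> p ^ e)%N finset.setT).
    apply: pow_ideal_sub => [|l]; first exact: (sat_ideal pP (ix _)).
    apply: frobP; apply: yP; have := pow_ideal_mem y (fun=> 1%N) l.
    by rewrite expr1.
  have := length_le_pow pP bound (q_gt0 h) (@length_ge_anti R P _ _ _ sub Lx).
  by rewrite prod_nat_const card_ord.
(* [q ^ h.+1 <= q ^ h * N] fails for [q = p ^ N > N]. *)
rewrite leqNgt; apply/negP => hn; have := key N.
have p_gt1 : (1 < p)%N by exact/prime_gt1/(pcharf_prime charR).
have q_gt0 := pchar_expn_gt0 charR N.
apply/negP; rewrite -ltnNge.
apply: (leq_trans (n := ((p ^ N) ^ h.+1)%N)); last by rewrite leq_pexp2l.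
by rewrite (expnSr _ h) ltn_pmul2l; [exact: ltn_expl|rewrite expn_gt0 q_gt0].
Qed.

(** Hence [P^{h(q-1)+1}] lies in [P^{[q]}] locally at [P], by the pigeonhole
    principle. *)
Lemma regular_prime_power e phi z : frob_linear p e phi ->
  ideal_exp P (h * (p ^ e).-1).+1 z -> P (phi z).
Proof.
move=> lphi Pz; have [n [x [nh Px Psat]]] := regular_prime_generators.
have [phiD phiZ] := lphi; have q_gt0 := pchar_expn_gt0 charR e.
have expsat N : ideal_exp P N `<=`
    sat P (ideal_exp (pow_sub R^o x (fun=> 1%N) finset.setT : set R) N).
  elim: N => [|N IHN]; first by apply: sub_sat.
  apply: ideal_mul_ind => [|u v /Psat[s ns Is] /IHN[t nt It]].
    exact/sat_ideal/ideal_exp_ideal.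
  exists (s * t); first exact: primeMN.
  by rewrite mulrACA; exact: ideal_mulP.
have [s ns /(@pow_ideal_pigeonhole _ _ x _ (fun=> p ^ e)%N)] := expsat _ _ Pz.
move=> /(_ (fun=> q_gt0)); rewrite sum_nat_const card_ord ltnS leq_mul2r nh orbT.
move=> /(_ isT)[w szE].
have : P (phi (s ^+ (p ^ e) * z)).
  rewrite -(prednK q_gt0) exprSr -mulrA szE mulr_sumr (frob_linear_sum _ _ _ lphi).
  apply: ideal_sum => // i _.
  have -> : s ^+ (p ^ e).-1 * (x i ^+ (p ^ e) *: w i) =
      x i ^+ (p ^ e) * (s ^+ (p ^ e).-1 * w i) by exact: mulrCA.
  by rewrite phiZ; exact: ideal_rmul.
by rewrite phiZ => /(primeM pP)[].
Qed.

End RegularPrimes.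

(** * Pairs *)

Section SurjectiveImage.
Context {R S : comNzRingType} (f : {rmorphism R -> S}).
Hypothesis f_surj : forall y, exists x, f x = y.
Implicit Types (I J : set R).

Lemma image_ideal J : is_ideal J -> is_ideal (f @` J).
Proof.
move=> iJ; split=> [|_ _ [x Jx <-] [y Jy <-]|a _ [x Jx <-]].
- by exists 0; [exact: ideal0|rewrite rmorph0].
- by exists (x + y); [exact: idealD|rewrite rmorphD].
- have [b <-] := f_surj a.
  by exists (b * x); [exact: ideal_lmul|rewrite rmorphM].
Qed.

Lemma preimage_ideal (J : set S) : is_ideal J -> is_ideal (f @^-1` J).
Proof.
move=> iJ; split=> [|x y /= Jx Jy|a x /= Jx].
- by rewrite /= rmorph0; exact: ideal0.
- by rewrite rmorphD; exact: idealD.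
- by rewrite rmorphM; exact: ideal_lmul.
Qed.

Lemma ideal_extE J : is_ideal J -> ideal_ext f J = f @` J.
Proof. by move=> iJ; apply: ideal_gen_id; exact: image_ideal. Qed.

Lemma image_ideal_mul I J : f @` ideal_mul I J = ideal_mul (f @` I) (f @` J).
Proof.
apply/seteqP; split.
  move=> _ [x IJx <-].
  suff : ideal_mul I J `<=` f @^-1` ideal_mul (f @` I) (f @` J) by apply.
  apply: ideal_mul_ind => [|u v Iu Jv].
    by apply: preimage_ideal; exact: ideal_mul_ideal.
  by rewrite /= rmorphM; apply: ideal_mulP; [exists u|exists v].
apply: ideal_mul_ind; first by apply: image_ideal; exact: ideal_mul_ideal.
move=> _ _ [u Iu <-] [v Jv <-].
by exists (u * v); [exact: ideal_mulP|rewrite rmorphM].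
Qed.

Lemma image_setT : f @` setT = setT.
Proof. by apply/seteqP; split=> // y _; have [x <-] := f_surj y; exists x. Qed.

Lemma image_ideal_exp J n : f @` ideal_exp J n = ideal_exp (f @` J) n.
Proof.
elim: n => [|n IHn]; first exact: image_setT.
by rewrite !ideal_expS image_ideal_mul IHn.
Qed.

Lemma image_ideal_big (T : Type) (r : seq T) (F : T -> set R) :
  f @` (\big[ideal_mul/setT]_(i <- r) F i) = \big[ideal_mul/setT]_(i <- r) (f @` F i).
Proof.
elim: r => [|i r IHr]; first by rewrite !big_nil image_setT.
by rewrite !big_cons image_ideal_mul IHr.
Qed.

End SurjectiveImage.

Lemma pair_powerE (K : realType) (A : comNzRingType) k (a : 'I_k -> set A) (t : 'I_k -> K) q :
  pair_power [seq (a i, t i) | i : 'I_k] q =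
  \big[ideal_mul/setT]_(i <- enum 'I_k) ideal_exp (a i) (Num.truncn (t i * (q - 1)%:R)).
Proof. by rewrite /pair_power big_map. Qed.

Lemma ideal_big_expX (T : eqType) (A : comNzRingType) (r : seq T) (F : T -> set A)
    (n : T -> nat) x k :
  (\big[ideal_mul/setT]_(i <- r) ideal_exp (F i) (n i)) x ->
  (\big[ideal_mul/setT]_(i <- r) ideal_exp (F i) (k * n i)) (x ^+ k).
Proof.
move=> Fx; elim: k => [|k IHk].
  rewrite expr0; under eq_bigr do rewrite mul0n.
  elim: r {Fx} => [|i r IHr]; first by rewrite big_nil.
  by rewrite big_cons -(mulr1 1); exact: ideal_mulP.
rewrite exprS; apply: ideal_mul_bigP Fx IHk => i u v _ Fu Fv.
by rewrite mulSn; exact: ideal_expD.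
Qed.

(** Rounding [t * (q1 - 1)] down loses less than [1], and passing from
    [t * (q1 * q2 - 1)] to [q2 * (t * (q1 - 1))] loses less than [q2 * t]. *)
Lemma truncn_mul_le (K : realType) (t : K) (M q1 q2 : nat) : 0 < t -> t + 1 <= M%:R ->
  (0 < q1)%N -> (0 < q2)%N ->
  (Num.truncn (t * (q1 * q2 - 1)%:R) <= q2 * (M + Num.truncn (t * (q1 - 1)%:R)))%N.
Proof.
move=> t0 tM q1_gt0 q2_gt0; rewrite truncn_le_nat -natr1.
set u := Num.truncn (t * (q1 - 1)%:R).
have uP : t * (q1 - 1)%:R < u%:R + 1 by rewrite natr1; exact: truncnS_gt.
have q2R : 0 < q2%:R :> K by rewrite ltr0n.
rewrite natrM natrD !natrB ?muln_gt0 ?q1_gt0 // natrM in uP *.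
have : t * q1%:R * q2%:R <= (M%:R + u%:R) * q2%:R by rewrite ler_pM2r //; lra.
by lra.
Qed.

(** * Strong F-regularity *)

Section StronglyFRegular.
Context {A : comNzRingType} {p : nat} (charA : p \in [pchar A]).

(** A splitting of one Frobenius power restricts to a splitting of the Frobenius,
    whose iterates split all powers. *)
Lemma F_split_all e d : (0 < e)%N -> root_splits charA e d ->
  forall e', exists2 f, frob_linear p e' f & f (1 : A) = 1.
Proof.
move=> e_gt0 /root_splitsP[g [gD gZ] gd].
have [f1 lf1 f11] : exists2 f, frob_linear p 1 f & f (1 : A) = 1.
  exists (fun y => g (d * y ^+ (p ^ e.-1))); last by rewrite expr1n mulr1.
  split=> [y z|a y]; first by rewrite (frobD charA) mulrDr gD.
  rewrite exprMn -exprM -expnD add1n prednK // mulrCA; exact: gZ.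
elim=> [|e' [f lf ff1]].
  by exists id => //; split=> // a y; rewrite expn0 expr1.
exists (fun y => f1 (f y)); last by rewrite ff1.
by rewrite -addn1; exact: frob_linear_comp.
Qed.

(** A splitting for one [q] is composed with splittings of further Frobenius powers.
    This loses in the rounded exponents, which is compensated by multiplying [c]
    beforehand by an element [x0] of sufficiently high powers of the ideals. *)
Lemma strongly_F_regular_large (K : realType) k (a : 'I_k -> set A) (t : 'I_k -> K)
    (M : 'I_k -> nat) (x0 : A) :
  (forall i, 0 < t i) -> (forall i, t i + 1 <= (M i)%:R) ->
  (\big[ideal_mul/setT]_(i <- enum 'I_k) ideal_exp (a i) (M i)) x0 ->
  off_minimal_primes x0 ->
  strongly_F_regular charA [seq (a i, t i) | i : 'I_k] ->
  forall c, off_minimal_primes c -> exists e0, forall e, (e0 <= e)%N ->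
  exists2 d, pair_power [seq (a i, t i) | i : 'I_k] (p ^ e) d &
             root_splits charA e (c * d).
Proof.
move=> t_gt0 tM ax0 offx0 sfr c offc.
have [|e0 e0_gt0 [d0]] := sfr (c * x0).
  by move=> P minP; have [pP _ _] := minP; apply: primeMN => //; [exact: offc|exact: offx0].
rewrite pair_powerE => ad0 split0.
have split_all := F_split_all e0_gt0 split0.
have [g lg g0] := (root_splitsP charA _ _).1 split0.
exists e0 => e /subnK <-; set e' := (e - e0)%N; have [f lf f1] := split_all e'.
have q_gt0 := pchar_expn_gt0 charA.
exists (c ^+ (p ^ e').-1 * (x0 * d0) ^+ (p ^ e')).
  rewrite pair_powerE; apply: ideal_lmul; first exact: ideal_mul_big_ideal.
  pose n i := (M i + Num.truncn (t i * (p ^ e0 - 1)%:R))%N.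
  apply: (@ideal_mul_big_sub _ _ _ (fun i => ideal_exp (a i) (p ^ e' * n i))).
    move=> i _; apply: ideal_exp_le; rewrite expnD mulnC.
    exact: truncn_mul_le.
  apply: ideal_big_expX; apply: ideal_mul_bigP ax0 ad0 => i u v _.
  exact: ideal_expD.
apply/root_splitsP; exists (fun y => g (f y)); first exact: frob_linear_comp.
rewrite mulrA -exprS prednK // -exprMn -(mulr1 (_ ^+ _)) mulrA.
by case: lf => _ ->; rewrite f1 mulr1.
Qed.

End StronglyFRegular.

(** * Lifting and descending along the quotient by a radical ideal *)

Section Adjunction.
Context {R : comNzRingType} {p : nat} (charR : p \in [pchar R]).
Variables (m : set R) (I : idealr R) (h : nat).
Hypotheses (hreg : regular_local_ring m) (hFfin : F_finite charR).
Hypotheses (hrad : radical_ideal [set` I]) (hunm : unmixed [set` I] h).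
Hypotheses (hht : ideal_height [set` I] h) (h_gt0 : (0 < h)%N).

Local Notation S := {ideal_quot I}.
Local Notation charS := (pchar_quot I charR).
Let pi : {rmorphism R -> S} := \pi_S%qT.
Let noeR : noetherian R. Proof. by case: hreg. Qed.
Let locR : local_ring m. Proof. by case: hreg. Qed.
Let pm : is_prime m. Proof. exact: local_maximal_prime locR. Qed.
Let im : is_ideal m. Proof. exact: prime_ideal. Qed.
Let iI : is_ideal [set` I]. Proof. exact: ideal_of_idealr. Qed.

Lemma quot_surj (s : S) : exists x, pi x = s.
Proof. by exists (repr s); exact: reprK. Qed.

Lemma quot_eq x y : pi x = pi y <-> [set` I] (x - y).
Proof. by rewrite /= Quotient.idealrBE; split=> [->|/eqP]. Qed.

Lemma quot_ideal_sub_max : [set` I] `<=` m.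
Proof. by apply: (local_proper_sub noeR locR) => //=; rewrite idealr1. Qed.

Lemma quot_one_unit x : pi x = 1 -> ~ m x.
Proof.
rewrite -(rmorph1 pi) => /quot_eq /quot_ideal_sub_max mx1 mx.
apply: (primeN1 pm); rewrite -(subKr x 1).
by apply: idealB => //; rewrite -opprB; exact: idealN.
Qed.

Lemma split_of_unit e f d : frob_linear p e f -> ~ m (f d) -> root_splits charR e d.
Proof.
move=> lf /(local_unit noeR locR)[u u1]; apply/root_splitsP.
by exists (fun y => u * f y) => //; exact: frob_linear_scale.
Qed.

Lemma frob_lift e (g : S -> S) : frob_linear p e g ->
  exists2 f, frob_linear p e f & forall y, pi (f y) = g (pi y).
Proof.
move=> lg; have [B] := regular_frob_basis hreg hFfin e.
have /choice[v vP] : forall i, exists v, pi v = g (pi (@fb_elt _ _ _ B i)).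
  by move=> i; exact: quot_surj.
exists (fb_map (B := B) v); first exact: fb_map_linear.
move=> y; rewrite {2}(fb_coordE B y) !rmorph_sum /= (frob_linear_sum _ _ _ lg).
by apply: eq_bigr => i _; rewrite !rmorphM rmorphXn vP; case: lg => _ ->.
Qed.

Lemma frob_lift_stable e (f : R -> R) (g : S -> S) : frob_linear p e g ->
  (forall y, pi (f y) = g (pi y)) -> forall z, [set` I] z -> [set` I] (f z).
Proof.
move=> lg fE z Iz; rewrite -(subr0 (f z)); apply/quot_eq; rewrite fE rmorph0.
rewrite -(frob_linear0 lg); congr g; rewrite -(rmorph0 pi).
by apply/quot_eq; rewrite subr0.
Qed.

Lemma frob_descend e f : frob_linear p e f -> (forall z, [set` I] z -> [set` I] (f z)) ->
  exists2 g : S -> S, frob_linear p e g & forall y, g (pi y) = pi (f y).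
Proof.
move=> lf fI; have [fD fZ] := lf.
have gE y : pi (f (repr (pi y))) = pi (f y).
  apply/quot_eq; rewrite -(frob_linearB _ _ lf); apply: fI; apply/quot_eq.
  exact: reprK.
exists (fun s => pi (f (repr s))) => //.
split=> [s s'|a s]; have [y <-] := quot_surj s.
  by have [y' <-] := quot_surj s'; rewrite -rmorphD !gE fD rmorphD.
by have [b <-] := quot_surj a; rewrite -rmorphXn -rmorphM !gE fZ rmorphM.
Qed.

(** ** Minimal primes of [I] *)

(** [I] being radical, [P] is locally equal to [I]. *)
Lemma minimal_prime_killed P z : minimal_prime_of [set` I] P -> P z ->
  exists2 s, ~ P s & [set` I] (s * z).
Proof.
move=> minP Pz; have [pP IP _] := minP.
have [n [s ns Isz]] := minimal_prime_nilpotent noeR iI minP Pz.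
exists s => //; apply: (hrad (n := n.+1)).
have -> : (s * z) ^+ n.+1 = (s ^+ n * z) * (s * z ^+ n) by rewrite exprS exprMn; ring.
exact: ideal_lmul.
Qed.

(** [P] is associated to [I]: the product of elements killing its generators modulo
    [I] has annihilator [P]. *)
Lemma minimal_prime_height P : minimal_prime_of [set` I] P -> prime_height P h.
Proof.
move=> minP; apply: hunm; have [pP IP _] := minP; split=> //.
have [s sE] := noeR (prime_ideal pP).
have [x nx xs] : exists2 x, ~ P x & forall z, z \in s -> [set` I] (z * x).
  have : forall z, z \in s -> P z by move=> z zs; rewrite sE; exact: sub_ideal_gen.
  elim: s {sE} => [|z s IHs] sP; first by exists 1 => //; exact: primeN1.
  have [|x nx xs] := IHs; first by move=> z' z's; apply: sP; rewrite inE z's orbT.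
  have [|u nu Iuz] := minimal_prime_killed (z := z) minP.
    by apply: sP; rewrite mem_head.
  exists (u * x); first exact: primeMN.
  move=> z'; rewrite inE => /predU1P[->|/xs Izx].
    by rewrite mulrA (mulrC z); exact: ideal_rmul.
  by rewrite mulrCA; exact: ideal_lmul.
exists x; apply/seteqP; split=> [|a /IP Pax]; last by case: (primeM pP Pax).
rewrite sE; apply: (ideal_gen_sub (ideal_colon_ideal x iI)) => z /xs.
by [].
Qed.

Lemma frob_minimal_prime e f P z : frob_linear p e f ->
  (forall z, [set` I] z -> [set` I] (f z)) -> minimal_prime_of [set` I] P ->
  P z -> P (f z).
Proof.
move=> [fD fZ] fI minP Pz; have [pP IP _] := minP.
have [s ns Isz] := minimal_prime_killed minP Pz.
have : P (s * f z).
  rewrite -fZ; apply: IP; apply: fI; rewrite -(prednK (pchar_expn_gt0 charR e)).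
  by rewrite exprSr -mulrA; exact: ideal_lmul.
by move=> /(primeM pP)[].
Qed.

Lemma off_minimal_primes_quot c :
  off_minimal_primes (pi c) <-> forall P, minimal_prime_of [set` I] P -> ~ P c.
Proof.
split=> [offc P [pP IP minP] Pc|offc Q [pQ _ minQ] Qc].
  have piP x : (pi @` P) (pi x) -> P x.
    move=> [y Py /quot_eq /IP Pyx]; rewrite -(subKr y x).
    by apply: idealB => //; exact: prime_ideal.
  apply: (offc (pi @` P)); last by exists c.
  have iP := prime_ideal pP; split.
  - split=> [||s s']; first exact: (image_ideal quot_surj).
      by rewrite -(rmorph1 pi) => /piP; exact: primeN1.
    have [x <-] := quot_surj s; have [y <-] := quot_surj s'.
    by rewrite -rmorphM => /piP/(primeM pP)[Px|Py]; [left; exists x|right; exists y].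
  - by move=> _ ->; exists 0; [exact: ideal0|rewrite rmorph0].
  - move=> Q pQ _ QP.
    have QE : pi @^-1` Q = P.
      apply: minP => [|x Ix|x /QP/piP //].
        split; first by apply: preimage_ideal; exact: prime_ideal.
          by rewrite /= rmorph1; exact: primeN1.
        by move=> x y /=; rewrite rmorphM; exact: primeM.
      have : Q (pi 0) by rewrite rmorph0; apply: ideal0; exact: prime_ideal.
      by have <- : pi x = pi 0 by apply/quot_eq; rewrite subr0.
    apply/seteqP; split=> // _ [x Px <-].
    by move: Px; rewrite -QE.
apply: (offc (pi @^-1` Q)) => //; have iQ := prime_ideal pQ; split.
- split; first exact: preimage_ideal.
    by rewrite /= rmorph1; exact: primeN1.
  by move=> x y /=; rewrite rmorphM; exact: primeM.
- move=> x Ix; have : Q (pi 0) by rewrite rmorph0; exact: ideal0.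
  by have <- : pi x = pi 0 by apply/quot_eq; rewrite subr0.
- move=> P pP IP PQ; have iP := prime_ideal pP.
  have piP x : (pi @` P) (pi x) -> P x.
    move=> [y Py /quot_eq /IP Pyx]; rewrite -(subKr y x).
    exact: idealB.
  have QE : pi @` P = Q.
    apply: minQ => [|_ ->|_ [x /PQ Qx <-] //].
      split; first exact: (image_ideal quot_surj).
        by rewrite -(rmorph1 pi) => /piP; exact: primeN1.
      move=> s s'; have [x <-] := quot_surj s; have [y <-] := quot_surj s'.
      by rewrite -rmorphM => /piP/(primeM pP)[Px|Py]; [left; exists x|right; exists y].
    by exists 0; [exact: ideal0|rewrite rmorph0].
  by apply/seteqP; split=> // x; rewrite -QE => /piP.
Qed.

(** The zero ideal of a domain is a prime of height [0]. *)
Lemma quot_ideal_neq0 : exists2 x, [set` I] x & x != 0.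
Proof.
apply: contrapT => no; have I0 x : [set` I] x -> x = 0.
  by move=> Ix; apply/eqP/negPn/negP => x0; apply: no; exists x.
have [d [x parx]] := regular_parameters hreg.
have p0 : is_prime [set 0 : R].
  split; first exact: ideal_set0.
    by move=> /= /eqP; rewrite oner_eq0.
  move=> u v; exact: regular_local_domain noeR locR parx _ _.
have := (hht.2 [set 0 : R] 0%N p0 I0); rewrite leqNgt h_gt0 => /(_ _)/negP; apply=> //.
split; first by exists (fun=> [set 0]) => //; split.
move=> c [//|l] [cp cS] cl; have [_] := cS l (ltnSn l); rewrite cl; case.
by move=> _ ->; apply: ideal0; apply: prime_ideal; apply: cp; exact: leqnSn.
Qed.

(** A map preserving [I] is a combination of maps [psi j (c j * _)] with [c j] in
    [I^{[q]} : I], as in Fedder's criterion.  This colon lies in [I^q : I], which is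
    [I^{q-1}] for large [q], and one of the maps does not send [d] into [m]. *)
Lemma fedder_lift : exists q0, forall e f d, (q0 <= p ^ e)%N -> frob_linear p e f ->
  (forall z, [set` I] z -> [set` I] (f z)) -> ~ m (f d) ->
  exists2 w, ideal_exp [set` I] (p ^ e - 1) w & root_splits charR e (w * d).
Proof.
have [x Ix x0] := quot_ideal_neq0; have [d' [y pary]] := regular_parameters hreg.
have [k0 k0P] : exists k0, forall k, (k0 <= k)%N -> forall f,
    (forall y, [set` I] y -> ideal_exp [set` I] k.+1 (f * y)) -> ideal_exp [set` I] k f.
  apply: (colon_exp noeR iI Ix) => u xu.
  by have [xE|] := regular_local_domain noeR locR pary xu; rewrite ?xE ?eqxx in x0 *.
exists k0.+1 => e f d qk lf fI nfd.
have [N [psi [lpsi dualP]]] := regular_dual_basis hreg hFfin e.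
have [c [fE cJ]] := dualP f lf.
have q_gt0 := pchar_expn_gt0 charR e.
have [j nj] : exists j, ~ m (psi j (c j * d)).
  apply: contrapT => no; apply: nfd; rewrite fE; apply: ideal_sum => // j _.
  by apply: contrapT => nj; apply: no; exists j.
exists (c j); last exact: split_of_unit nj.
apply: k0P => [|z Iz]; first by rewrite -ltnS subn1 prednK.
rewrite subn1 prednK // mulrC.
have : ideal_gen [set y | exists2 a, [set` I] a & y = a ^+ (p ^ e)] (z * c j).
  by apply: cJ => u; apply: fI; exact: ideal_rmul.
apply: ideal_gen_sub => [|_ [u Iu ->]]; first exact: ideal_exp_ideal.
exact: ideal_expX.
Qed.

(** Multiplication by an element of [I^{h(q-1)}] makes any Frobenius-linear map
    compatible with [I], since [I^{h(q-1)+1}] is locally in [I^{[q]}]. *)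
Lemma power_descends e (B : set R) c d :
  ideal_mul (ideal_exp [set` I] (h * (p ^ e - 1))) B d -> root_splits charR e (c * d) ->
  exists2 b, B b & root_splits charS e (pi c * pi b).
Proof.
move=> IBd /root_splitsP[f lf fd]; have [fD fZ] := lf.
(* As [R] is local, [d] may be replaced by one of the products it is a sum of. *)
have [u [b [Iu Bb nub]]] : exists u b,
    [/\ ideal_exp [set` I] (h * (p ^ e - 1)) u, B b & ~ m (f (c * (u * b)))].
  apply: contrapT => no; apply: (primeN1 pm); rewrite -fd.
  suff : ideal_mul (ideal_exp [set` I] (h * (p ^ e - 1))) B `<=`
      [set z | forall r, m (f (c * (r * z)))] by move=> /(_ _ IBd)/(_ 1); rewrite mul1r.
  apply: ideal_mul_ind => [|u b Iu Bb r].
    split=> [r|z z' mz mz' r|a z mz r].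
    - by rewrite !mulr0 (frob_linear0 lf); exact: ideal0.
    - by rewrite !mulrDr fD; exact: idealD.
    - by have := mz (r * a); rewrite -(mulrA r).
  apply: contrapT => nm; apply: no; exists (r * u), b; split=> //.
    by apply: ideal_lmul => //; exact: ideal_exp_ideal.
  by rewrite -mulrA.
exists b => //; have lfu := frob_linear_mul u lf.
have fuI z : [set` I] z -> [set` I] (f (u * z)).
  move=> Iz; apply: (radical_primeP noeR) => // Q pQ IQ.
  have [l lmin lcov] := noetherian_minimal_primes noeR iI.
  have [P /lmin minP PQ] := lcov _ pQ IQ; apply: PQ; have [pP IP _] := minP.
  have powP := regular_prime_power hreg hFfin pP (minimal_prime_height minP) lf.
  have : ideal_exp P (h * (p ^ e - 1)).+1 (z * u).
    apply: ideal_mulP; first exact: IP.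
    suff sub n : ideal_exp [set` I] n `<=` ideal_exp P n by exact: sub.
    by elim: n => // n IHn; exact: ideal_mul_sub.
  by rewrite mulrC subn1; exact: powP.
have [g lg gE] := frob_descend lfu fuI.
have [v v1] := local_unit noeR locR nub.
apply/root_splitsP; exists (fun s => pi v * g s); first exact: frob_linear_scale.
by rewrite -rmorphM gE -rmorphM -(rmorph1 pi) -v1 mulrCA.
Qed.

(** ** Pairs on [R] and on [S] *)

Section PairsOverQuotient.
Variables (K : realType) (k : nat) (a : 'I_k -> set R) (t : 'I_k -> K).
Hypotheses (ha : forall i, is_ideal (a i)) (ht : forall i, 0 < t i).

Local Notation aR := [seq (a i, t i) | i : 'I_k].
Local Notation aS := [seq (ideal_ext (quot_map I) (a i), t i) | i : 'I_k].

Lemma pair_power_quot q : pair_power aS q = pi @` pair_power aR q.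
Proof.
rewrite !pair_powerE (image_ideal_big quot_surj); apply: eq_bigr => i _.
by rewrite (image_ideal_exp quot_surj) -(ideal_extE quot_surj).
Qed.

Lemma pair_power_cons s (q : nat) : pair_power (([set` I], s%:R) :: aR) q =
  ideal_mul (ideal_exp [set` I] (s * (q - 1))) (pair_power aR q).
Proof. by rewrite /pair_power big_cons /= -natrM natrK. Qed.

Lemma F_pure_adjunction : F_pure charS aS -> F_pure charR (([set` I], 1) :: aR).
Proof.
move=> [q0 pureS]; have [q1 lift] := fedder_lift; exists (maxn q0 q1) => e e_gt0.
rewrite geq_max => /andP[q0e q1e]; have [s] := pureS e e_gt0 q0e.
rewrite pair_power_quot => -[d ad <-] /root_splitsP[g lg gd].
have [f lf fE] := frob_lift lg.
have fI := frob_lift_stable lg fE.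
have nfd : ~ m (f d) by apply: quot_one_unit; rewrite fE.
have [w Iw wd] := lift e f d q1e lf fI nfd.
exists (w * d) => //; rewrite -[1]/(1%:R) pair_power_cons mul1n.
exact: ideal_mulP.
Qed.

Lemma F_pure_restriction : F_pure charR (([set` I], h%:R) :: aR) -> F_pure charS aS.
Proof.
move=> [q0 pureR]; exists q0 => e e_gt0 q0e; have [d] := pureR e e_gt0 q0e.
rewrite pair_power_cons -(mul1r d) => Iad splitd.
have [] := @power_descends e (pair_power aR (p ^ e)) 1 d; first by rewrite -(mul1r d).
  by [].
move=> b ab; rewrite rmorph1 mul1r => splitb; exists (pi b) => //.
by rewrite pair_power_quot; exists b.
Qed.

Lemma strongly_F_regular_restriction : (forall i, [set` I] `<=` a i) ->
  purely_F_regular charR (([set` I], h%:R) :: aR) -> strongly_F_regular charS aS.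
Proof.
move=> Ia pfr s; have [c <-] := quot_surj s => /off_minimal_primes_quot offc.
have [l lmin lcov] := noetherian_minimal_primes noeR iI.
have [d' [y pary]] := regular_parameters hreg.
have [||q0 q0P] := pfr c.
- move=> P [pP _ minP] Pc; have [Q /lmin minQ _] := lcov _ pm quot_ideal_sub_max.
  apply: (offc Q minQ); have [pQ _ _] := minQ.
  have PE : [set 0] = P.
    apply: minP => // [|_ ->]; last exact: (ideal0 (prime_ideal pP)).
    split; [exact: ideal_set0|by move=> /= /eqP; rewrite oner_eq0|].
    by move=> u v; exact: regular_local_domain noeR locR pary _ _.
  by move: Pc; rewrite -PE => ->; apply: ideal0; exact: prime_ideal.
- move=> P [pP IaP minP]; apply: offc.
  have IPE Q : is_prime Q -> pair_product (([set` I], h%:R) :: aR) `<=` Q -> [set` I] `<=` Q.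
    move=> pQ; rewrite /pair_product big_cons /=.
    move=> /(prime_mul_sub pQ)[//|]; rewrite big_map => /(prime_big_sub pQ)[i _ aQ].
    exact: subset_trans (Ia i) aQ.
  split=> // [|Q pQ IQ QP]; first exact: IPE.
  apply: minP => //; apply: subset_trans IQ; rewrite /pair_product big_cons.
  exact: ideal_mul_subl.
have p_gt1 : (1 < p)%N by exact/prime_gt1/(pcharf_prime charR).
have [|d] := q0P q0.+1 isT.
  by apply: ltnW; apply: leq_trans (ltn_expl _ p_gt1); exact: leqnSn.
rewrite pair_power_cons => Iad splitd; exists q0.+1 => //.
have [b ab splitb] := power_descends Iad splitd.
by exists (pi b) => //; rewrite pair_power_quot; exists b.
Qed.

(** Strong F-regularity tested on a high power of an element of [m] outside the
    minimal primes of [I] produces a splitting for a large [q], when the exponent of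
    [a i] is positive; but all maps compatible with [I] preserve [P].  If [I = m] there
    is no such element. *)
Lemma strongly_F_regular_nsub :
  ([set` I] = m -> forall i, ~ (a i `<=` m)) -> strongly_F_regular charS aS ->
  forall P, minimal_prime_of [set` I] P -> forall i, ~ (a i `<=` P).
Proof.
move=> field sfr P minP i aP; have [pP IP _] := minP.
have prime_m Q : is_prime Q -> Q `<=` m.
  by move=> pQ; apply: (local_proper_sub noeR locR); [exact: prime_ideal|exact: primeN1].
have [Im|nIm] := pselect ([set` I] = m).
  by apply: (field Im i); apply: subset_trans aP _; exact: prime_m.
have [l lmin lcov] := noetherian_minimal_primes noeR iI.
have [||c mc avc] := @prime_avoidance R m 0 l im.
- by move=> Q /lmin[].
- move=> Q /lmin[pQ IQ minQ] [_ mQ]; apply: nIm; apply/seteqP; split.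
    exact: quot_ideal_sub_max.
  move=> x mx; apply: (radical_primeP noeR) => // Q' pQ' IQ'.
  have QQ' : Q' = Q.
    by apply: minQ => //; apply: subset_trans mQ; exact: prime_m.
  by rewrite QQ'; exact: mQ.
(* For [q > N] the exponent of [a i] is positive. *)
pose N := (Num.truncn (t i)^-1).+1.
have tN : 1 <= t i * N%:R.
  by rewrite mulrC -ler_pdivrMr ?ht // div1r ltW // truncnS_gt.
have [|e e_gt0 [s]] := sfr (pi (c ^+ N)).
  apply/off_minimal_primes_quot => Q minQ; have [pQ IQ _] := minQ.
  apply: primeXN => // Qc; have [Q' Q'l Q'Q] := lcov _ pQ IQ.
  have [_ _ minQ'] := minQ; have [pQ' IQ' _] := lmin _ Q'l.
  by apply: (avc _ Q'l); rewrite add0r (minQ' _ pQ' IQ' Q'Q).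
rewrite pair_power_quot => -[d ad <-] /root_splitsP[g lg gd].
have [f lf fE] := frob_lift lg; have [fD fZ] := lf.
have fI := frob_lift_stable lg fE.
have nfd : ~ m (f (c ^+ N * d)) by apply: quot_one_unit; rewrite fE rmorphM.
(* If [q <= N], a factor [c] comes out of [f]. *)
have [qN|Nq] := leqP (p ^ e) N.
  apply: nfd; rewrite -(subnKC qN) exprD -mulrA fZ; exact: ideal_rmul.
apply: nfd; apply: (prime_m _ pP).
apply: (frob_minimal_prime lf fI minP).
apply: ideal_lmul; first exact: prime_ideal.
apply: aP; move: ad; rewrite pair_powerE => /(ideal_mul_big_le (i := i)) aid.
have : ideal_exp (a i) (Num.truncn (t i * (p ^ e - 1)%:R)) d.
  by apply: aid; [move=> j _; exact: ideal_exp_ideal|rewrite mem_enum].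
apply: ideal_exp_sub => //; rewrite truncn_gt_nat; apply: le_trans tN _.
by rewrite ler_pM2l // ler_nat; lia.
Qed.

Lemma purely_F_regular_adjunction :
  ([set` I] = m -> forall i, ~ (a i `<=` m)) ->
  strongly_F_regular charS aS -> purely_F_regular charR (([set` I], 1) :: aR).
Proof.
move=> field sfr c _ offc; have nsub := strongly_F_regular_nsub field sfr.
have offcI : off_minimal_primes (pi c).
  apply/off_minimal_primes_quot => P minP; have [pP IP minP'] := minP; apply: offc.
  split=> // [|Q pQ IaQ QP].
    apply: subset_trans IP; rewrite /pair_product big_cons; exact: ideal_mul_subl.
  apply: minP' => //; move: IaQ; rewrite /pair_product big_cons big_map.
  move=> /(prime_mul_sub pQ)[//|/(prime_big_sub pQ)[i _ aQ]].
  by case: (nsub _ minP i); exact: subset_trans aQ QP.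
pose M i := (Num.truncn (t i)).+2.
have tM i : t i + 1 <= (M i)%:R.
  by rewrite /M -natr1 lerD2r ltW // truncnS_gt.
have [l lmin lcov] := noetherian_minimal_primes noeR iI.
pose aM := \big[ideal_mul/setT]_(i <- enum 'I_k) ideal_exp (a i) (M i).
have iaM : is_ideal aM by exact: ideal_mul_big_ideal.
have [||x0 ax0 avx0] := @prime_avoidance R aM 0 l iaM.
- by move=> Q /lmin[].
- move=> Q /lmin minQ [_ aQ]; have [pQ _ _] := minQ.
  have [i _ /(prime_exp_sub pQ)] := prime_big_sub pQ aQ; exact: nsub.
have offx0 : off_minimal_primes (pi x0).
  apply/off_minimal_primes_quot => Q minQ; have [pQ IQ minQ'] := minQ.
  have [Q' Q'l Q'Q] := lcov _ pQ IQ; have [pQ' IQ' _] := lmin _ Q'l.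
  by have := avx0 _ Q'l; rewrite add0r (minQ' _ pQ' IQ' Q'Q).
have ax0S : (\big[ideal_mul/setT]_(i <- enum 'I_k)
    ideal_exp (ideal_ext (quot_map I) (a i)) (M i)) (pi x0).
  suff -> : \big[ideal_mul/setT]_(i <- enum 'I_k)
    ideal_exp (ideal_ext (quot_map I) (a i)) (M i) = pi @` aM by exists x0.
  rewrite (image_ideal_big quot_surj); apply: eq_bigr => i _.
  by rewrite (image_ideal_exp quot_surj) -(ideal_extE quot_surj).
have [e1 e1P] := strongly_F_regular_large ht tM ax0S offx0 sfr offcI.
have [q1 lift] := fedder_lift; exists (maxn (p ^ e1) q1) => e e_gt0.
have p_gt1 : (1 < p)%N by exact/prime_gt1/(pcharf_prime charR).
rewrite geq_max leq_exp2l // => /andP[/e1P[s] + + q1e].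
rewrite pair_power_quot => -[d ad <-] /root_splitsP[g lg gd].
have [f lf fE] := frob_lift lg.
have fI := frob_lift_stable lg fE.
have nfd : ~ m (f (c * d)) by apply: quot_one_unit; rewrite fE rmorphM.
have [w Iw wd] := lift e f _ q1e lf fI nfd.
exists (w * d); last by rewrite mulrCA.
by rewrite -[1]/(1%:R) pair_power_cons mul1n; exact: ideal_mulP.
Qed.

End PairsOverQuotient.

End Adjunction.

Theorem theorem3p11 (K : realType) (R : comNzRingType) (m : set R) (p : nat)
    (charR : p \in [pchar R]) (I : idealr R) (h k : nat)
    (a : 'I_k -> set R) (t : 'I_k -> K)
    (hreg : regular_local_ring m) (hFfin : F_finite charR)
    (hrad : radical_ideal [set` I]) (hunm : unmixed [set` I] h)
    (hht : ideal_height [set` I] h) (h_gt0 : (0 < h)%N)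
    (ha : forall i, is_ideal (a i)) (ht : forall i, 0 < t i) :
  let charS := pchar_quot I charR in
  let aR := [seq (a i, t i) | i : 'I_k] in
  let aS := [seq (ideal_ext (quot_map I) (a i), t i) | i : 'I_k] in
  [/\ (* The first premise only excludes the case where S is a field and some
         a_i S is 0; there S can be strongly F-regular merely because
         (a_i S) ^ floor (t_i (q - 1)) = 0 ^ 0 = S for small q. *)
      ([set` I] = m -> forall i, ~ (a i `<=` m)) ->
        strongly_F_regular charS aS ->
        purely_F_regular charR (([set` I], 1) :: aR),
      F_pure charS aS -> F_pure charR (([set` I], 1) :: aR),
      F_pure charR (([set` I], h%:R) :: aR) -> F_pure charS aS
    & (forall i, [set` I] `<=` a i) ->
        purely_F_regular charR (([set` I], h%:R) :: aR) ->
        strongly_F_regular charS aS].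
Proof.
move=> charS aR aS; split.
- exact: (purely_F_regular_adjunction hreg hFfin hrad hht h_gt0 ha ht).
- exact: (F_pure_adjunction hreg hFfin hht h_gt0 ha).
- exact: (F_pure_restriction hreg hFfin hrad hunm ha).
- exact: (strongly_F_regular_restriction hreg hFfin hrad hunm ha).
Qed.
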